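(* The solutions $(\widetilde{p},\mathbf{v})$ to the boundary value problem (flow through porous media under the Barus model with conservative body force) $$\widetilde{\mu}_0(\mathbf{x})\, g\big(\widetilde{p}(\mathbf{x})\big)\,\mathbf{K}^{-1}(\mathbf{x})\,\mathbf{v}(\mathbf{x}) + \mathrm{grad}\big[\widetilde{p}(\mathbf{x})\big] = \mathbf{0} \ \text{in } \Omega,\qquad \mathrm{div}\big[\mathbf{v}(\mathbf{x})\big]=0 \ \text{in } \Omega,$$ $$\widetilde{p}(\mathbf{x})=\widetilde{p}_{\mathrm{p}}(\mathbf{x})\ \text{on } \Gamma^{p},\qquad \mathbf{v}(\mathbf{x})\cdot\widehat{\mathbf{n}}(\mathbf{x}) = v_n(\mathbf{x})\ \text{on } \Gamma^{v}$$ are unique. That is, if $(\widetilde{p}^{(1)},\mathbf{v}^{(1)})$ and $(\widetilde{p}^{(2)},\mathbf{v}^{(2)})$ are two solutions with the same prescribed data $(\widetilde{p}_{\mathrm{p}},v_n)$, then $\widetilde{p}^{(1)}(\mathbf{x})=\widetilde{p}^{(2)}(\mathbf{x})$ and $\mathbf{v}^{(1)}(\mathbf{x})=\mathbf{v}^{(2)}(\mathbf{x})$ for all $\mathbf{x}\in\overline{\Omega}$.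
   Context: $\Omega\subset\mathbb{R}^{nd}$ is the domain ($nd$ is the number of spatial dimensions), with closure $\overline{\Omega}$, boundary $\partial\Omega=\overline{\Omega}\setminus\Omega$ and unit outward normal $\widehat{\mathbf{n}}(\mathbf{x})$; $\mathrm{grad}$ and $\mathrm{div}$ are the spatial gradient and divergence. The boundary is divided into two complementary parts, $\Gamma^{p}\cup\Gamma^{v}=\partial\Omega$ and $\Gamma^{p}\cap\Gamma^{v}=\emptyset$: pressure is prescribed on $\Gamma^{p}$, and the normal component of the velocity, $v_n(\mathbf{x})$, is prescribed on $\Gamma^{v}$. If $\Gamma^{v}=\partial\Omega$, the prescribed velocity must satisfy the compatibility condition $\int_{\partial\Omega} v_n\,\mathrm{d}\Gamma=0$. $\mathbf{v}(\mathbf{x})$ is the Darcy velocity and $p(\mathbf{x})$ the pressure. The permeability $\mathbf{K}(\mathbf{x})$ is a symmetric, positive definite (hence invertible) tensor field for which there are constants $0<k_1\le k_2$ with $k_1\,\boldsymbol{\zeta}\cdot\boldsymbol{\zeta}\le \boldsymbol{\zeta}\cdot\mathbf{K}(\mathbf{x})\boldsymbol{\zeta}\le k_2\,\boldsymbol{\zeta}\cdot\boldsymbol{\zeta}$ for all $\mathbf{x}\in\Omega$ and all $\boldsymbol{\zeta}\in\mathbb{R}^{nd}\setminus\{\mathbf 0\}$. The viscosity follows the Barus model $\mu=\mu_0\exp\left[\beta\left(\frac{p(\mathbf{x})}{p_0}-1\right)\right]$, where $\beta\ge 0$ is a dimensionless constant, $p_0$ is the reference pressure (often atmospheric pressure),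 and $\mu_0$ is the viscosity at the reference pressure. The body force is conservative, $\rho\,\mathbf{b}(\mathbf{x})=-\mathrm{grad}[\xi(\mathbf{x})]$ for some scalar field $\xi$, where $\rho$ is the fluid density and $\mathbf{b}$ the specific body force. The modified pressure is $\widetilde{p}(\mathbf{x})=p(\mathbf{x})+\xi(\mathbf{x})$, and $\widetilde{p}_{\mathrm{p}}(\mathbf{x})=p_{\mathrm{p}}(\mathbf{x})+\xi(\mathbf{x})$, with $p_{\mathrm{p}}$ the pressure prescribed on $\Gamma^{p}$. Finally, $$\widetilde{\mu}_0(\mathbf{x})=\mu_0\exp\left[-\frac{\beta\,\xi(\mathbf{x})}{p_0}\right]>0,\qquad g\big(\widetilde{p}(\mathbf{x})\big)=\exp\left[\beta\left(\frac{\widetilde{p}(\mathbf{x})}{p_0}-1\right)\right],$$ so that $\mu=\widetilde{\mu}_0(\mathbf{x})\,g\big(\widetilde{p}(\mathbf{x})\big)$.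
   Formalization: Pressure is claimed unique only when Γ^p is nonempty (if Γ^v = ∂Ω, pressure is never unique, e.g. v = 0 with any constant pressure); velocity is unique in all cases. Ω is taken bounded and connected with piecewise C^1 boundary, and solutions are classical. *)

(* Defs.v *)
From HB Require Import structures.
From mathcomp Require Import all_boot all_order all_algebra.
From mathcomp Require Import all_classical all_reals all_analysis.

Set Implicit Arguments.
Unset Strict Implicit.
Unset Printing Implicit Defensive.

Import Order.TTheory GRing.Theory Num.Theory.
Import numFieldNormedType.Exports.

Local Open Scope classical_set_scope.
Local Open Scope ring_scope.

(* Points and vectors of R^n are row vectors. The library norm on ['rV[R]_n] is
   the sup norm; it induces the usual topology, but unit normals and diameters
   need the Euclidean norm [enorm]. *)
Section vector_calculus.
Variables (R : realType) (n : nat).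
Implicit Types (x y u w : 'rV[R]_n) (f : 'rV[R]_n -> R).

Definition dot u w : R := \sum_i u 0 i * w 0 i.

Definition enorm u : R := Num.sqrt (dot u u).

(* The product [A u], with [u] read as a column vector. *)
Definition mxapply (A : 'M[R]_n) u : 'rV[R]_n := (A *m u^T)^T.

Definition grad f x : 'rV[R]_n := \row_i 'D_(delta_mx 0 i) f x.

Definition divergence (F : 'rV[R]_n -> 'rV[R]_n) x : R :=
  \sum_i 'D_(delta_mx 0 i) (fun y => F y 0 i) x.

(* Intended for open [A]. *)
Definition C1_on (V : normedModType R) (A : set 'rV[R]_n) (f : 'rV[R]_n -> V) :=
  (forall x, A x -> differentiable f x) /\
  (forall u, {within A, continuous (fun x => 'D_u f x)}).

Definition C1_in_C0_closure (V : normedModType R) (Omega : set 'rV[R]_n)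
    (f : 'rV[R]_n -> V) :=
  C1_on Omega f /\ {within closure Omega, continuous f}.

End vector_calculus.

Section hausdorff.
Variables (R : realType) (n : nat).
Implicit Types A : set 'rV[R]_n.
Local Open Scope ereal_scope.

Definition diam A : \bar R :=
  ereal_sup [set r | exists x y, [/\ A x, A y & r = (enorm (x - y))%:E]].

(* The separate case makes the empty set weigh 0 also for [s = 0], where
   [diam A ^+ 0 = 1]; thus [s = 0] gives the counting measure. *)
Definition hausdorff_weight (s : nat) A : \bar R :=
  if A == set0 then 0 else diam A ^+ s.

Definition hausdorff_pre (s : nat) (delta : R) A : \bar R :=
  ereal_inf [set r | exists U : nat -> set 'rV[R]_n,
    [/\ A `<=` \bigcup_k U k,
        forall k, diam (U k) <= delta%:E &
        r = \sum_(0 <= k <oo) hausdorff_weight s (U k)]].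

(* The [s]-dimensional Hausdorff (outer) measure, without the normalising
   constant that makes it agree with surface area: that constant is irrelevant
   for null sets and for integrals that are required to vanish. *)
Definition hausdorff (s : nat) A : \bar R :=
  ereal_sup [set r | exists2 delta : R, (0 < delta)%R &
                       r = hausdorff_pre s delta A].

(* Integral over [A] with respect to [hausdorff n.-1] on the Borel sets. *)
Definition surface_integral A (f : 'rV[R]_n -> R) : \bar R :=
  integral (T := g_sigma_algebraType (@open 'rV[R]_n))
    (hausdorff n.-1) A (fun x => (f x)%:E).

End hausdorff.

Section domains.
Variables (R : realType) (n : nat).
Implicit Types (Omega U : set 'rV[R]_n) (x nu : 'rV[R]_n).

(* For open [Omega] this is the topological boundary. *)
Definition bdry Omega : set 'rV[R]_n := closure Omega `\` Omega.

(* Near [x], [Omega] is the sublevel set of a C^1 function whose gradient does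
   not vanish at [x], i.e. it lies on one side of a C^1 hypersurface through
   [x]; [nu] is the normalised gradient of that function. *)
Definition outward_unit_normal Omega x nu :=
  exists (U : set 'rV[R]_n) (phi : 'rV[R]_n -> R),
    [/\ open U, U x, C1_on U phi &
        [/\ forall y, U y -> (Omega y <-> phi y < 0),
            phi x = 0,
            grad phi x != 0 &
            nu = (enorm (grad phi x))^-1 *: grad phi x]].

Definition regular_bdry Omega : set 'rV[R]_n :=
  [set x | bdry Omega x /\ exists nu, outward_unit_normal Omega x nu].

(* Bounded domain with piecewise C^1 boundary: the boundary points without a C^1
   normal (edges, corners, ...) form a set of vanishing (n-1)-dimensional
   measure. In dimension 1 there are none. *)
Definition piecewise_C1_domain Omega :=
  [/\ open Omega, connected Omega, Omega !=set0, bounded_set Omega &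
      hausdorff n.-1 (bdry Omega `\` regular_bdry Omega) = 0%E].

End domains.

Section barus.
Variables (R : realType) (n : nat).
Implicit Types (Omega Gp Gv : set 'rV[R]_n) (K : 'rV[R]_n -> 'M[R]_n).

Definition permeability Omega K (k1 k2 : R) :=
  [/\ 0 < k1, k1 <= k2,
      forall x, Omega x -> (K x)^T = K x &
      forall x (z : 'rV[R]_n), Omega x -> z != 0 ->
        k1 * dot z z <= dot z (mxapply (K x) z) <= k2 * dot z z].

(* [mut] is the modified reference viscosity, a field; the viscosity is
   [mut x * barus p0 beta (p x)] with [p] the modified pressure. *)
Definition mut (mu0 beta p0 : R) (xi : 'rV[R]_n -> R) (x : 'rV[R]_n) : R :=
  mu0 * expR (- (beta * xi x / p0)).

Definition barus (beta p0 q : R) : R := expR (beta * (q / p0 - 1)).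

(* Classical solutions. The velocity condition is imposed at the points of [Gv]
   at which an outward unit normal exists. *)
Record solution Omega Gp Gv (m : 'rV[R]_n -> R) (g : R -> R) K
    (ppt vn : 'rV[R]_n -> R)
    (p : 'rV[R]_n -> R) (v : 'rV[R]_n -> 'rV[R]_n) : Prop := Solution {
  solution_p_C1 : C1_in_C0_closure Omega p ;
  solution_v_C1 : C1_in_C0_closure Omega v ;
  solution_darcy : forall x, Omega x ->
    (m x * g (p x)) *: mxapply (invmx (K x)) (v x) + grad p x = 0 ;
  solution_div : forall x, Omega x -> divergence v x = 0 ;
  solution_Gp : forall x, Gp x -> p x = ppt x ;
  solution_Gv : forall x nu, Gv x -> outward_unit_normal Omega x nu ->
    dot (v x) nu = vn x
}.

End barus.

(* Main.v *)
(* The Kirchhoff transform P = G(p), G' = 1/g, makes Darcy's law linear: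
   mut K^-1 v + grad P = 0. For two solutions put q = P1 - P2, w = v1 - v2 and
   F = q w. Then div F = w . grad q = - mut (w . K^-1 w) <= 0, while F vanishes on
   Gp and F . n = 0 at the regular points of Gv, so a divergence theorem gives
   div F = 0, hence w = 0 and grad q = 0.
   Since div F has a sign, no integral is needed: means over the nodes of a
   uniform mesh of a large cube are enough. Summation by parts against a cutoff
   chi vanishing near the boundary gives
     mean (chi div_h F) = - mean (F . grad_h chi),
   and the right-hand side is made small by taking for chi a product of factors:
   around the singular boundary points, balls of radii r with small sum of
   r^(n-1); around a regular point, a function of phi / eps with phi a defining
   function, whose gradient is almost orthogonal to F on a layer of volume
   O(eps). *)

Require Import Defs.
From HB Require Import structures.
From mathcomp Require Import all_boot all_order all_algebra.
From mathcomp Require Import all_classical all_reals all_analysis.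
From mathcomp Require Import ring lra.

Set Implicit Arguments.
Unset Strict Implicit.
Unset Printing Implicit Defensive.

Import Order.TTheory GRing.Theory Num.Theory.
Import numFieldNormedType.Exports.

Local Open Scope classical_set_scope.
Local Open Scope ring_scope.

(** * Directional derivatives *)

(** Subtracting the two Darcy laws in their original form leaves a term containing g(p1) - g(p2),
    which has no sign; this is what the transform removes. The obstacle in the divergence theorem is
    regularity: F is continuous up to the boundary, but its derivatives are controlled only inside
    Omega, so div F may be unbounded and the derivatives must be moved to the cutoff. Two scalings
    decide what can be cut off. Around a singular point the cutoff has slope 1/r on a volume of
    order r^n, which costs r^(n-1), and only boundedness of F is used. Across a C^1 piece, slope
    1/eps on a volume of order eps gives a cost of order 1, so thin layers alone gain nothing:
    smallness comes from F . grad phi tending to 0 at the boundary. There Gp and Gv need no separate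
    treatment, since both give F . n = 0. The contradiction is local: if div F < 0 at one point,
    then div F <= -d on a ball, and a cutoff equal to 1 on that ball keeps a fixed negative mean
    while its cost is arbitrarily small. *)

Section directional.
Variables (R : realType) (n : nat).
Implicit Types (x y v : 'rV[R]_n) (f : 'rV[R]_n -> R).

Lemma rV_norm_leP x (r : R) : 0 <= r ->
  reflect (forall i, `|x 0 i| <= r) (`|x| <= r).
Proof.
move=> r0; rewrite [`|x|]/Num.norm /= mx_normrE.
apply: (iffP (bigmax_leP _ _ _ _)) => [[_ H] i|H]; first exact: (H (0, i)).
by split=> // -[j i] _; rewrite (ord1 j).
Qed.

Lemma rV_norm_ltP x (r : R) : 0 < r ->
  reflect (forall i, `|x 0 i| < r) (`|x| < r).
Proof.
move=> r0; rewrite [`|x|]/Num.norm /= mx_normrE.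
apply: (iffP (bigmax_ltP _ _ _ _)) => [[_ H] i|H]; first exact: (H (0, i)).
by split=> // -[j i] _; rewrite (ord1 j).
Qed.

Lemma rV_coord_le x i : `|x 0 i| <= `|x|.
Proof. exact/rV_norm_leP. Qed.

Definition e_ i : 'rV[R]_n := delta_mx 0 i.

Lemma norm_scale_e (t : R) i : `|t *: e_ i| = `|t|.
Proof.
apply/eqP; rewrite eq_le; apply/andP; split.
  apply/rV_norm_leP => // j; rewrite !mxE eqxx /=.
  by case: eqP; rewrite ?mulr1 ?mulr0 ?normr0.
by apply: le_trans (rV_coord_le _ i); rewrite !mxE !eqxx mulr1.
Qed.

Lemma line_is_derive f x v (t : R) : derivable f (x + t *: v) v ->
  is_derive t 1 (fun s : R => f (x + s *: v)) ('D_v f (x + t *: v)).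
Proof.
have E : (fun h : R => h^-1 *: (((fun s : R => f (x + s *: v)) \o shift t)
             (h *: (1:R)) - f (x + t *: v)))
       = (fun h : R => h^-1 *: ((f \o shift (x + t *: v)) (h *: v)
             - f (x + t *: v))).
  apply/funext => h /=; congr (_ *: (f _ - _)).
  by rewrite scalerDl [h *: (1:R)]mulr1 addrCA.
move=> df; apply: DeriveDef; first by rewrite /derivable E.
by rewrite /derive E.
Qed.

(** The increment [t] may have either sign, since the mesh uses backward differences as well.
    Writing the intermediate point as [s * t] with [s] in [0, 1] lets one statement serve both signs
    and [t = 0]. *)
Lemma dir_MVT f x v (t : R) :
  (forall s : R, 0 <= s <= 1 -> derivable f (x + (s * t) *: v) v) ->
  exists2 s : R, 0 <= s <= 1 & f (x + t *: v) - f x = t * 'D_v f (x + (s * t) *: v).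
Proof.
move=> df; have [->|t0] := eqVneq t 0.
  by exists 0; rewrite ?lexx ?ler01 // scale0r addr0 subrr mul0r.
pose g s := f (x + s *: v).
have g0 : g 0 = f x by rewrite /g scale0r addr0.
have dg (s : R) : 0 <= s / t <= 1 -> is_derive s 1 g ('D_v f (x + s *: v)).
  by move=> /df; rewrite divfK //; exact: line_is_derive.
have cg a b : (forall s, s \in `[a, b] -> 0 <= s / t <= 1) ->
    {within `[a, b], continuous (g : R -> R)}.
  move=> H; apply: derivable_within_continuous => s /H/dg.
  by case.
suff [c ct E] : exists2 c, 0 <= c / t <= 1 & g t - g 0 = t * 'D_v f (x + c *: v).
  by exists (c / t); rewrite // divfK // -g0.
have [tp|tn|t00] := ltgtP 0 t; last by rewrite t00 eqxx in t0.
- have H s : s \in `[0, t] -> 0 <= s / t <= 1.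
    by rewrite in_itv /= ler_pdivrMr // mul1r => /andP[s0 ->]; rewrite divr_ge0 // ltW.
  have H' (s : R) : s \in `]0, t[ -> is_derive s 1 g ('D_v f (x + s *: v)).
    by move=> s_; apply: dg; apply: H; apply: subset_itv_oo_cc.
  have [c /H ct E] := MVT_segment (ltW tp) H' (cg _ _ H).
  by exists c => //; rewrite E subr0 mulrC.
- have H s : s \in `[t, 0] -> 0 <= s / t <= 1.
    rewrite in_itv /= ler_ndivrMr // mul1r => /andP[-> s0].
    by rewrite mulr_le0 // invr_le0 ltW.
  have H' (s : R) : s \in `]t, 0[ -> is_derive s 1 g ('D_v f (x + s *: v)).
    by move=> s_; apply: dg; apply: H; apply: subset_itv_oo_cc.
  have [c /H ct E] := MVT_segment (ltW tn) H' (cg _ _ H).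
  exists c => //; rewrite -[LHS]opprK opprB E sub0r.
  by rewrite mulrN opprK mulrC.
Qed.

(* Stated with [nbhs 0] rather than [0^'] so that no inequation on [t] has to be
   carried around. *)
Lemma near_dir_diff f (df : 'rV[R]_n -> R) x v (e : R) : 0 < e ->
  (\forall y \near x, is_derive y v f (df y)) -> {for x, continuous df} ->
  \forall y \near x & t \near (0 : R),
    `|f (y + t *: v) - f y - t * df y| <= e * `|t|.
Proof.
move=> e0 /nbhs_ballP[r1 /= r10 dfP] cf.
(* Half of [e]: the derivatives at the base point and at the intermediate point are both compared
   with [df x]. *)
have /nbhs_ballP[r2 /= r20 H2] : \forall y \near x, `|df x - df y| < e / 2.
  by apply: (@cvgr_dist_lt _ R^o _ _ _ _ _ cf); rewrite divr_gt0.
pose r := Num.min r1 r2; have r0 : 0 < r by rewrite lt_min r10.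
have v0 : 0 < `|v| + 1 by rewrite ltr_wpDl.
have near2 : forall y (s : R), ball x (r / 2) y -> `|s| < r / 2 / (`|v| + 1) ->
    ball x r (y + s *: v).
  move=> y s; rewrite -!ball_normE /= => yx; rewrite ltr_pdivlMr // => sv.
  rewrite opprD addrA (le_lt_trans (ler_normB _ _)) // [ltRHS](splitr r) ltrD //.
  by rewrite normrZ; apply: le_lt_trans sv; rewrite ler_wpM2l // lerDl.
exists (ball x (r / 2), ball (0:R) (r / 2 / (`|v| + 1))) => /=.
  split; first by apply: nbhsx_ballx; rewrite divr_gt0.
  by apply: nbhsx_ballx; rewrite !divr_gt0.
move=> [y t] /= [yx]; rewrite -ball_normE /= sub0r normrN => tr.
have inb (s : R) : `|s| <= `|t| -> ball x r (y + s *: v).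
  by move=> st; apply: near2 => //; exact: le_lt_trans tr.
have le1 u : ball x r u -> is_derive u v f (df u).
  by move=> ur; apply: dfP; apply: le_ball ur; rewrite ge_min lexx.
have le2 u : ball x r u -> `|df x - df u| < e / 2.
  by move=> ur; apply: H2; apply: le_ball ur; rewrite ge_min lexx orbT.
have st (s : R) : 0 <= s <= 1 -> `|s * t| <= `|t|.
  by case/andP=> s0 s1; rewrite normrM ger0_norm // ler_piMl.
have [s s01 ->] : exists2 s : R, 0 <= s <= 1 &
    f (y + t *: v) - f y = t * 'D_v f (y + (s * t) *: v).
  by apply: dir_MVT => s /st/inb/le1[].
have ys := inb _ (st _ s01); have [_ ->] := le1 _ ys.
rewrite -mulrBr normrM mulrC ler_wpM2r //.
have /le2 : ball x r y.
  by rewrite -[y](addr0) -(scale0r v); apply: inb; rewrite normr0.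
have := le2 _ ys.
by rewrite !ltr_norml ler_norml => /andP[A B] /andP[C D]; apply/andP; split; lra.
Qed.

Lemma differentiable_is_derive f x v : differentiable f x ->
  is_derive x v f ('D_v f x).
Proof. by move=> /diff_derivable/derivableP. Qed.

Lemma is_derive_chain f (g : R -> R) x v (df dg : R) : differentiable f x ->
  is_derive x v f df -> is_derive (f x) 1 g dg ->
  is_derive x v (g \o f) (dg * df).
Proof.
move=> fx [_ <-] [gx <-].
have gd : differentiable g (f x) by apply/derivable1_diffP.
have gfd := differentiable_comp fx gd.
apply: DeriveDef; first exact: diff_derivable.
rewrite !deriveE // diff_comp //= -[X in 'd g (f x) X]mulr1.
by rewrite [X in 'd g (f x) X](_ : _ = 'd f x v *: (1 : R)) // linearZ /= mulrC.
Qed.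

End directional.

(** * A C^1 transition function *)

Definition sqplus (R : realType) (t : R) : R := Num.max 0 t ^+ 2.

(** The square of the positive part is C^1, so applying it twice gives a C^1 descent from 1 on t <=
    0 to 0 on t >= 1, with an explicit derivative. *)
Definition smoothstep (R : realType) (t : R) : R := sqplus (1 - sqplus t).

Definition dsmoothstep (R : realType) (t : R) : R :=
  2 * Num.max 0 (1 - sqplus t) * - (2 * Num.max 0 t).

Section smoothstep.
Variable R : realType.
Implicit Types t : R.

(** With a quadratic error bound the kink of the positive part needs no separate limits: sign cases
    and polynomial inequalities suffice. *)
Lemma is_derive_quadratic (f : R -> R) t (d : R) :
  (forall h, `|f (t + h) - f t - d * h| <= h ^+ 2) -> is_derive t 1 f d.
Proof.
move=> H.
have C : h^-1 *: ((f \o shift t) (h *: (1 : R)) - f t) @[h --> 0^'] --> d.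
  apply/cvgrPdist_le => e e0; near=> h.
  have h0 : h != 0 by near: h; exact: nbhs_dnbhs_neq.
  have -> : d - h^-1 *: ((f \o shift t) (h *: (1 : R)) - f t) =
      - (h^-1 * (f (t + h) - f t - d * h)).
    rewrite /= [h *: 1]mulr1 [h + t]addrC -[h^-1 *: _]/(h^-1 * _).
    by field.
  rewrite normrN normrM; apply: (@le_trans _ _ (`|h^-1| * `|h| ^+ 2)).
    by rewrite ler_wpM2l // real_normK ?num_real.
  rewrite expr2 mulrA -normrM mulVf // normr1 mul1r.
  near: h; apply: dnbhs0_le; exact: e0.
by apply: DeriveDef; [apply/cvg_ex; exists d | exact/cvg_lim].
Unshelve. all: by end_near. Qed.

Lemma maxr0E t : Num.max 0 t = if 0 <= t then t else 0.
Proof. by case: (leP 0 t). Qed.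

Lemma is_derive_sqplus t : is_derive t 1 (@sqplus R) (2 * Num.max 0 t).
Proof.
apply: is_derive_quadratic => h; rewrite /sqplus !maxr0E ler_norml.
by do 2 (case: ifPn; rewrite -?ltNge => ?); apply/andP; split; nra.
Qed.

Lemma is_derive_smoothstep t : is_derive t 1 (@smoothstep R) (dsmoothstep t).
Proof.
have H : is_derive t 1 (fun u : R => 1 - sqplus u) (- (2 * Num.max 0 t)).
  have H1 := is_derive_sqplus t; have H0 := is_derive_cst (1 : R) t (1 : R).
  by apply: (is_derive_eq (is_deriveB H0 H1)); rewrite sub0r.
exact: is_derive1_comp (is_derive_sqplus _) H.
Qed.

Lemma smoothstep01 t : 0 <= smoothstep t <= 1.
Proof.
rewrite /smoothstep /sqplus sqr_ge0 /= expr_le1 // ?le_max ?lexx //.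
by rewrite ge_max ler01 gerBl sqr_ge0.
Qed.

Lemma smoothstep_le0 t : t <= 0 -> smoothstep t = 1.
Proof.
by move=> t0; rewrite /smoothstep /sqplus (max_l t0) expr0n subr0 max_r ?expr1n.
Qed.

Lemma smoothstep_ge1 t : 1 <= t -> smoothstep t = 0.
Proof.
move=> t1; have t0 : 0 <= t := le_trans ler01 t1.
by rewrite /smoothstep {2}/sqplus (max_r t0) /sqplus max_l ?expr0n // subr_le0 expr_ge1.
Qed.

Lemma dsmoothstep_le0 t : t <= 0 -> dsmoothstep t = 0.
Proof. by move=> t0; rewrite /dsmoothstep (max_l t0) !mulr0 oppr0 mulr0. Qed.

Lemma dsmoothstep_ge1 t : 1 <= t -> dsmoothstep t = 0.
Proof.
move=> t1; have t0 : 0 <= t := le_trans ler01 t1.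
rewrite /dsmoothstep /sqplus (max_r t0) (@max_l _ _ 0 (1 - _)) ?mulr0 ?mul0r //.
by rewrite subr_le0 expr_ge1.
Qed.

Lemma dsmoothstep_le4 t : `|dsmoothstep t| <= 4.
Proof.
have [t0|t0] := leP t 0; first by rewrite dsmoothstep_le0 ?normr0.
have [t1|t1] := leP 1 t; first by rewrite dsmoothstep_ge1 ?normr0.
have -> : (4 : R) = 2 * 2 by rewrite -natrM.
rewrite /dsmoothstep normrM normrN !normrM (ger0_norm (ler0n R 2)).
have m0 : `|Num.max 0 t| <= 1 by rewrite max_r ?ltW // gtr0_norm // ltW.
have m1 : `|Num.max 0 (1 - sqplus t)| <= 1.
  rewrite ger0_norm ?le_max ?lexx //.
  by rewrite ge_max ler01 gerBl sqr_ge0.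
by apply: ler_pM => //; rewrite -[leRHS]mulr1 ler_wpM2l.
Qed.

Lemma continuous_dsmoothstep : continuous (@dsmoothstep R).
Proof.
have cm (g : R -> R) : continuous g -> continuous (fun t : R => Num.max 0 (g t)).
  move=> cg t; apply: continuous_max; [exact: cvg_cst | exact: cg].
have cid : continuous (fun t : R => t) by move=> t; exact: cvg_id.
have csq : continuous (@sqplus R).
  move=> t; apply: cvgM; [| ]; exact: cm.
move=> t; apply: cvgM.
  apply: cvgM; first exact: cvg_cst.
  by apply: (cm (fun t => 1 - sqplus t)) => u; apply: cvgB; [exact: cvg_cst|exact: csq].
by apply: cvgN; apply: cvgM; [exact: cvg_cst | exact: cm].
Qed.

End smoothstep.

(** * Means over a uniform mesh *)

Section lattice.
Variables (R : realType) (n : nat) (M : R).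
Hypothesis M0 : 0 < M.
Implicit Types (x y : 'rV[R]_n) (f g : 'rV[R]_n -> R) (A : set 'rV[R]_n).

(** [N.+1] steps divide [-M, M], so each coordinate has [N.+2] nodes and the faces of the cube carry
    nodes. *)
Definition mesh (N : nat) : R := 2 * M / N.+1%:R.

Lemma mesh_gt0 N : 0 < mesh N.
Proof. by rewrite divr_gt0 ?mulr_gt0. Qed.

Lemma mesh_cvg0 : mesh @ \oo --> (0 : R).
Proof.
rewrite -(mulr0 (2 * M)); apply: cvgM; first exact: cvg_cst.
exact: cvg_harmonic.
Qed.

Definition node N (k : {ffun 'I_n -> 'I_N.+2}) : 'rV[R]_n :=
  \row_i (mesh N * (k i)%:R - M).

(** Discrete counterpart of the integral over the cube [-M, M]^n divided by (2M)^n. *)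
Definition mean N f : R :=
  (\sum_k f (@node N k)) / #|{ffun 'I_n -> 'I_N.+2}|%:R.

Lemma card_nodes_gt0 N : 0 < #|{ffun 'I_n -> 'I_N.+2}|%:R :> R.
Proof. by rewrite ltr0n card_ffun card_ord expn_gt0. Qed.

Lemma meanD N f g : mean N (fun x => f x + g x) = mean N f + mean N g.
Proof. by rewrite /mean big_split /= mulrDl. Qed.

Lemma meanN N f : mean N (fun x => - f x) = - mean N f.
Proof. by rewrite /mean sumrN mulNr. Qed.

Lemma meanZ N (c : R) f : mean N (fun x => c * f x) = c * mean N f.
Proof. by rewrite /mean -mulr_sumr mulrA. Qed.

Lemma mean_cst N (c : R) : mean N (fun=> c) = c.
Proof.
rewrite /mean sumr_const -[c *+ _]mulr_natr mulfK //.
by rewrite gt_eqF // card_nodes_gt0.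
Qed.

Lemma le_mean N f g : (forall x, f x <= g x) -> mean N f <= mean N g.
Proof.
move=> fg; rewrite /mean ler_wpM2r ?invr_ge0 ?ler_sum //.
Qed.

Lemma eq_mean N f g : (forall x, f x = g x) -> mean N f = mean N g.
Proof. by move=> fg; congr mean; apply/funext. Qed.

Section summation_by_parts.
Variables (N : nat) (i : 'I_n).

Let up (k : {ffun 'I_n -> 'I_N.+2}) :=
  [ffun j => if j == i then ordS (k j) else k j].
Let down (k : {ffun 'I_n -> 'I_N.+2}) :=
  [ffun j => if j == i then ord_pred (k j) else k j].

Let upK : cancel up down.
Proof.
by move=> k; apply/ffunP => j; rewrite !ffunE; case: eqP; rewrite ?ordSK.
Qed.

Let downK : cancel down up.
Proof.
by move=> k; apply/ffunP => j; rewrite !ffunE; case: eqP; rewrite ?ord_predK.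
Qed.

Let norm_node_ge (k : {ffun 'I_n -> 'I_N.+2}) : (k i == ord0) || (k i == ord_max) -> M <= `|@node N k|.
Proof.
move=> ki; apply: le_trans (rV_coord_le _ i); rewrite mxE.
case/orP: ki => /eqP -> /=; first by rewrite mulr0 sub0r normrN ler_norm.
by rewrite mulfVK ?pnatr_eq0 // mulr2n mulrDl mul1r addrK ler_norm.
Qed.

Let node_up (k : {ffun 'I_n -> 'I_N.+2}) : k i != ord_max -> node (up k) = node k + mesh N *: e_ R i.
Proof.
move=> ki; apply/rowP => j; rewrite !mxE ffunE eqxx /=.
case: eqP => [->|_]; last by rewrite mulr0 addr0.
rewrite mulr1 /= modn_small ?mulrSr; first by ring.
by rewrite ltn_neqAle ltn_ord andbT; apply: contra ki => /eqP[E]; apply/eqP/val_inj.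
Qed.

Let node_down (k : {ffun 'I_n -> 'I_N.+2}) : k i != ord0 -> node (down k) = node k - mesh N *: e_ R i.
Proof.
move=> ki; have := @node_up (down k); rewrite downK => -> //.
  by rewrite addrK.
rewrite ffunE eqxx; apply: contra ki => /eqP/(congr1 (@ordS _)).
rewrite ord_predK => ->; apply/eqP/val_inj => /=; exact: modnn.
Qed.

(** [up] and [down] are inverse cyclic shifts of the nodes, so reindexing produces no boundary
    terms. They differ from translation by a mesh step only where they wrap around, at nodes on a
    face, and there the factor in front of the difference vanishes. *)
Lemma mean_by_parts f g :
  (forall x, M <= `|x| -> f x = 0) -> (forall x, M <= `|x| -> g x = 0) ->
  mean N (fun x => f x * (g (x + mesh N *: e_ R i) - g x)) =
  - mean N (fun x => g x * (f x - f (x - mesh N *: e_ R i))).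
Proof.
move=> f0 g0; rewrite -meanN /mean; congr (_ / _).
transitivity (\sum_k (f (node k) * (g (@node N (up k)) - g (node k)))).
  apply: eq_bigr => k _.
  have [ki|ki] := boolP (k i == ord_max); last by rewrite node_up.
  by rewrite f0 ?mul0r // norm_node_ge // ki orbT.
transitivity (\sum_k - (g (node k) * (f (@node N k) - f (node (down k))))); last first.
  apply: eq_bigr => k _.
  have [ki|ki] := boolP (k i == ord0); last by rewrite node_down.
  by rewrite g0 ?mul0r // norm_node_ge // ki.
under eq_bigr do rewrite mulrBr; rewrite sumrB.
under [RHS]eq_bigr do rewrite mulrBr opprB; rewrite sumrB.
congr (_ - _); last by apply: eq_bigr => k _; rewrite mulrC.
rewrite (reindex_inj (can_inj downK)) /=; apply: eq_bigr => k _.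
by rewrite downK mulrC.
Qed.

End summation_by_parts.

(** * Counting nodes: upper and lower volume bounds *)

Lemma card_close N (P : pred 'I_N.+2) (D : R) : 0 <= D ->
  (forall m m', P m -> P m' -> `|m%:R - m'%:R| <= D) -> #|P|%:R <= D + 1.
Proof.
move=> D0 H; have [m0 Pm0|P0] := pickP P; last first.
  by rewrite eq_card0 // addr_ge0.
(* Counted from its least element, [P] lies among [truncn D + 1] consecutive integers. *)
case: (arg_minnP (fun m : 'I_N.+2 => val m) Pm0) => m1 Pm1 Hm1.
have trD : (Num.truncn D)%:R <= D by have := truncn_itv D0 => /andP[].
apply: (@le_trans _ _ (Num.truncn D).+1%:R); last by rewrite mulrSr lerD2r.
rewrite ler_nat -(size_iota m1 (Num.truncn D).+1) cardE -(size_map val); apply: uniq_leq_size.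
  by rewrite map_inj_uniq ?enum_uniq //; exact: val_inj.
move=> _ /mapP[m + ->]; rewrite mem_enum => Pm; rewrite mem_iota.
have m1m := Hm1 _ Pm; rewrite m1m /= addnS ltnS -leq_subLR.
rewrite truncn_ge_nat // natrB //.
exact: le_trans (ler_norm _) (H _ _ Pm Pm1).
Qed.

(** A count exceeds length over mesh size by at most one node, whose share is [N.+2%:R^-1]. This
    rounding term persists in the upper volume bounds and tends to 0. *)
Lemma card_close_mesh N (P : pred 'I_N.+2) (l : R) : 0 <= l ->
  (forall m m', P m -> P m' -> `|mesh N * m%:R - mesh N * m'%:R| <= l) ->
  #|P|%:R / N.+2%:R <= l / (2 * M) + N.+2%:R^-1.
Proof.
move=> l0 H; rewrite ler_pdivrMr // mulrDl mulVf ?pnatr_eq0 //.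
apply: le_trans (@card_close _ P (l / mesh N) _ _) _.
- by rewrite divr_ge0 // ltW // mesh_gt0.
- move=> m m' Pm Pm'; rewrite ler_pdivlMr ?mesh_gt0 // mulrC.
  by rewrite -{1}(gtr0_norm (mesh_gt0 N)) -normrM mulrBr; exact: H.
rewrite lerD2r /mesh invf_div mulrA [leRHS]mulrAC.
rewrite ler_wpM2r ?invr_ge0 ?mulr_ge0 ?(ltW M0) //.
by rewrite ler_wpM2l // ler_nat.
Qed.

(** Cavalieri's principle on the nodes: each line in direction [i] meets [A] within a length [l],
    and the mean over the cube is the average of the means over these lines. *)
Lemma mean_slab N i A (l : R) : 0 <= l ->
  (forall x y, A x -> A y -> (forall j, j != i -> x 0 j = y 0 j) ->
     `|x 0 i - y 0 i| <= l) ->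
  mean N \1_A <= l / (2 * M) + N.+2%:R^-1.
Proof.
move=> l0 H.
pose upd (k : {ffun 'I_n -> 'I_N.+2}) m := [ffun j => if j == i then m else k j].
pose a k : R := \1_A (@node N k).
have E : (\sum_k a k) * N.+2%:R = \sum_k \sum_m a (upd k m).
  rewrite pair_big /= mulr_suml.
  transitivity (\sum_(k : {ffun 'I_n -> 'I_N.+2}) \sum_(m < N.+2) a k).
    by apply: eq_bigr => k _; rewrite sumr_const card_ord mulr_natr.
  rewrite pair_big /=.
  (* Exchanging the [i]-th coordinate of [k] with [m] is an involution on pairs; it turns a sum of
     [a k] that ignores [m] into a sum along the line through [k]. *)
  pose s (p : {ffun 'I_n -> 'I_N.+2} * 'I_N.+2) := (upd p.1 p.2, p.1 i).
  have sK : cancel s s.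
    move=> [k m]; rewrite /s /= ffunE eqxx; congr pair.
    by apply/ffunP => j; rewrite !ffunE; case: eqP => [->|].
  by rewrite (reindex_inj (can_inj sK)).
rewrite -(ler_pM2r (_ : 0 < N.+2%:R)) // [leLHS]mulrAC E ler_pdivrMr ?card_nodes_gt0 //.
rewrite mulr_natr -sumr_const; apply: ler_sum => k _.
rewrite -ler_pdivrMr //.
have -> : \sum_m a (upd k m) = #|[pred m | node (upd k m) \in A]|%:R.
  rewrite -sum1_card natr_sum [RHS]big_mkcond /=; apply: eq_bigr => m _.
  by rewrite /a indicE inE; case: ifP.
apply: card_close_mesh => // m m' /set_mem Am /set_mem Am'.
have := H _ _ Am Am'; rewrite !mxE !ffunE eqxx opprB addrA subrK; apply.
by move=> j /negPf ji; rewrite !mxE !ffunE ji.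
Qed.

Lemma card_nodes N : #|{ffun 'I_n -> 'I_N.+2}|%:R = \prod_(i < n) N.+2%:R :> R.
Proof. by rewrite prodr_const card_ord -natrX card_ffun !card_ord. Qed.

(** In the sup norm a ball is a product of intervals, so its indicator is a product over coordinates
    and the sum over nodes factors into one-dimensional counts. *)
Lemma mean_cube N y A (r : R) : 0 <= r ->
  (forall x, A x -> `|x - y| <= r) ->
  mean N \1_A <= (r / M + N.+2%:R^-1) ^+ n.
Proof.
move=> r0 H; pose P i (m : 'I_N.+2) := `|mesh N * m%:R - M - y 0 i| <= r.
have PE i : #|P i|%:R = \sum_m (P i m)%:R :> R.
  rewrite -(sum1_card (P i)) natr_sum big_mkcond /=; apply: eq_bigr => m _.
  by rewrite unfold_in -/(P i m); case: (P i m).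
apply: (@le_trans _ _ (\prod_(i < n) (#|P i|%:R / N.+2%:R))).
  rewrite prodf_div -card_nodes ler_wpM2r ?invr_ge0 //.
  rewrite (eq_bigr _ (fun i _ => PE i)) bigA_distr_bigA /=; apply: ler_sum => k _.
  rewrite indicE; case: (boolP (_ \in A)) => [/set_mem Ak|_]; last exact: prodr_ge0.
  rewrite big1 // => i _; suff /= -> : P i (k i) by [].
  apply: le_trans (H _ Ak); apply: le_trans (rV_coord_le _ i).
  by rewrite !mxE.
rewrite -[n in leRHS]card_ord -prodr_const; apply: ler_prod => i _.
rewrite divr_ge0 //=.
have -> : r / M = 2 * r / (2 * M) by rewrite -mulf_div divff ?mul1r.
apply: card_close_mesh => [|m m']; first by rewrite mulr_ge0.
by rewrite /P /= !ler_norml => /andP[? ?] /andP[? ?]; apply/andP; split; lra.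
Qed.

Lemma mean_ball_ge y (r : R) : 0 < r -> `|y| + r <= M ->
  \forall N \near \oo, (r / (4 * M)) ^+ n <= mean N \1_(ball y r).
Proof.
move=> r0 yr; near=> N.
pose P i (m : 'I_N.+2) := `|mesh N * m%:R - M - y 0 i| < r.
have PE i : #|P i|%:R = \sum_m (P i m)%:R :> R.
  rewrite -(sum1_card (P i)) natr_sum big_mkcond /=; apply: eq_bigr => m _.
  by rewrite unfold_in -/(P i m); case: (P i m).
apply: (@le_trans _ _ (\prod_(i < n) (#|P i|%:R / N.+2%:R))); last first.
  rewrite prodf_div -card_nodes ler_wpM2r ?invr_ge0 //.
  rewrite (eq_bigr _ (fun i _ => PE i)) bigA_distr_bigA /=; apply: ler_sum => k _.
  have [kP|/forallPn[i ki]] := boolP [forall i, P i (k i)]; last first.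
    by rewrite (bigD1 i) //= (negPf ki) mul0r.
  rewrite indicE mem_set; last first.
    rewrite -ball_normE /= distrC; apply/rV_norm_ltP => // i.
    by have := forallP kP i; rewrite /P !mxE.
  by rewrite big1 // => i _; rewrite (forallP kP i).
rewrite -[n in leLHS]card_ord -prodr_const; apply: ler_prod => i _.
rewrite divr_ge0 ?mulr_ge0 ?(ltW r0) ?(ltW M0) //=.
have h0 := mesh_gt0 N.
have yM : 0 <= y 0 i + M /\ y 0 i + r <= M.
  have : `|y 0 i| <= M - r by rewrite (le_trans (rV_coord_le y i)) // lerBrDr.
  by rewrite ler_norml => /andP[? ?]; split; lra.
set c := (y 0 i + M) / mesh N; set rho := r / mesh N.
have c0 : 0 <= c by rewrite divr_ge0 ?(ltW h0) //; case: yM.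
have rho0 : 0 <= rho by rewrite divr_ge0 ?ltW.
have /andP[c1 c2] := truncn_itv c0; have /andP[rho1 rho2] := truncn_itv rho0.
have cr : c + rho <= N.+1%:R.
  rewrite /c /rho -mulrDl ler_pdivrMr // mulrC /mesh mulfVK ?pnatr_eq0 //.
  by case: yM; lra.
(* [c] and [rho] are the centre, measured from -M, and the radius in mesh units. Only the
   [truncn rho] indices from [truncn c] upwards are counted, about half of the interval; absorbing
   the rounding loses another factor 2, whence the 4 in the bound. *)
have lt_N (j : 'I_(Num.truncn rho)) : (Num.truncn c + j < N.+2)%N.
  rewrite ltnS -(ler_nat R) natrD (le_trans _ cr) // lerD // (le_trans _ rho1) //.
  by rewrite ler_nat ltnW.
pose s j := Ordinal (lt_N j).
apply: (@le_trans _ _ ((Num.truncn rho)%:R / N.+2%:R)); last first.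
  rewrite ler_wpM2r ?invr_ge0 // ler_nat -[X in (X <= _)%N]card_ord.
  have s_inj : injective s by move=> j j' [] /addnI/val_inj.
  rewrite -(fintype.card_image s_inj).
  apply: subset_leq_card; apply/fintype.subsetP => _ /fintype.imageP[j _ ->].
  rewrite unfold_in /P /= natrD.
  have hc : mesh N * c = y 0 i + M by rewrite mulrC mulfVK // gt_eqF.
  have hr : mesh N * rho = r by rewrite mulrC mulfVK // gt_eqF.
  rewrite -addrA -opprD [M + _]addrC -hc -mulrBr normrM gtr0_norm // -[ltRHS]hr ltr_pM2l //.
  have : j.+1%:R <= rho by apply: le_trans rho1; rewrite ler_nat.
  by rewrite -natr1 in c2 * => ?; have := ler0n R j; rewrite ltr_norml; move=> ?; apply/andP; split; lra.
rewrite ler_pdivlMr //; apply: (@le_trans _ _ (rho - 1)); last first.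
  by rewrite lerBlDr natr1 ltW.
have NM : 4 * M <= r * N%:R.
  rewrite mulrC -ler_pdivrMl // mulrC.
  by near: N; exact: nbhs_infty_ger.
have -> : rho = r * N.+1%:R * 2 / (4 * M).
  by rewrite /rho /mesh; field; rewrite ?gt_eqF // pnatr_eq0.
rewrite -[X in _ - X](@divff _ (4 * M)) ?gt_eqF ?mulr_gt0 // -mulrBl mulrAC.
rewrite ler_wpM2r ?invr_ge0 ?mulr_ge0 ?(ltW M0) //.
by rewrite -!natr1; lra.
Unshelve. all: by end_near.
Qed.

End lattice.

(** * Cutoff functions *)

Definition clamp (R : realType) (t : R) : R := Num.max 0 (Num.min 1 t).

Section clamp.
Variable R : realType.
Implicit Types s t : R.

Lemma clamp01 t : 0 <= clamp t <= 1.
Proof. by rewrite /clamp le_max lexx ge_max ler01 ge_min lexx. Qed.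

Lemma clamp_eq0 t : t <= 0 -> clamp t = 0.
Proof. by move=> t0; rewrite /clamp max_l // ge_min t0 orbT. Qed.

Lemma clamp_eq1 t : 1 <= t -> clamp t = 1.
Proof. by move=> t1; rewrite /clamp (min_l t1) max_r. Qed.

Lemma clamp_lip s t : `|clamp s - clamp t| <= `|s - t|.
Proof.
have E (u : R) : clamp u = if u <= 0 then 0 else if 1 <= u then 1 else u.
  case: ifPn => [/clamp_eq0//|]; rewrite -ltNge => u0.
  case: ifPn => [/clamp_eq1//|]; rewrite -ltNge => u1.
  by rewrite /clamp min_r ?max_r ?ltW.
have H (u w : R) : u <= w -> `|clamp u - clamp w| <= `|u - w|.
  move=> uw; rewrite (@ler0_norm _ (u - w)) ?subr_le0 // ler_norml !E.
  by repeat case: ifPn; rewrite -?ltNge => *; apply/andP; split; lra.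
by have [/H//|/ltW/H] := leP s t; rewrite distrC (distrC t).
Qed.

End clamp.

Section cutoff.
Variables (R : realType) (n : nat) (M : R).
Hypothesis M0 : 0 < M.
Variables (Omega B : set 'rV[R]_n) (F : 'rV[R]_n -> 'rV[R]_n) (MF : R).
Hypothesis MF0 : 0 <= MF.
Hypothesis FMF : forall x i, Omega x -> `|F x 0 i| <= MF.
Implicit Types (x y : 'rV[R]_n) (a b : 'rV[R]_n -> R) (E : set 'rV[R]_n).

Local Notation h := (mesh M).

(** Discrete F . grad a. The differences are backward because summation by parts turns the forward
    differences of [F] into these. *)
Definition dflux a N x : R :=
  \sum_i F x 0 i * ((a x - a (x - h N *: e_ R i)) / h N).

(* The cost [kappa] bounds the upper limit of the mean of [|F . grad a|]; costs add
   up under products, which makes partitions of unity unnecessary. *)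
Record cutoff E (kappa : R) a : Prop := Cutoff {
  cutoff01 : forall x, 0 <= a x <= 1 ;
  cutoff_lip : exists L : R, \forall N \near \oo, forall x i,
    `|a x - a (x - h N *: e_ R i)| <= L * h N ;
  cutoffB : forall x, B x -> a x = 1 ;
  cutoff_bdry : forall x, E x -> bdry Omega x -> \forall y \near x, a y = 0 ;
  cutoff_cost : forall e : R, 0 < e -> \forall N \near \oo,
    mean M N (fun x => \1_Omega x * `|dflux a N x|) <= kappa + e }.

(** A capacity weighted by [F]: what it costs to cut off the part of the boundary lying in [E]
    without changing the value 1 on [B]. *)
Definition removable E kappa := exists a, cutoff E kappa a.

Lemma removable_sub E E' (k k' : R) : E `<=` E' -> k' <= k ->
  removable E' k' -> removable E k.
Proof.
move=> EE' kk' [a [a01 aL aB a0 ac]]; exists a; split=> //.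
  by move=> x /EE'; exact: a0.
move=> e /ac; apply: filterS => N /le_trans; apply.
by rewrite lerD2r.
Qed.

Lemma removable0 : removable set0 0.
Proof.
exists (fun=> 1); split=> //.
- by move=> x; rewrite ler01 lexx.
- by exists 0; near=> N => x i; rewrite subrr normr0 mul0r.
- move=> e e0; near=> N.
  have -> : mean M N (fun x => \1_Omega x * `|dflux (fun=> 1) N x|) =
      mean M N (fun _ : 'rV[R]_n => 0).
    apply: eq_mean => x; rewrite /dflux big1 ?normr0 ?mulr0 // => i _.
    by rewrite subrr mul0r mulr0.
  by rewrite mean_cst add0r ltW.
Unshelve. all: by end_near. Qed.

Lemma dflux_mul a b N x : dflux (fun y => a y * b y) N x =
  b x * dflux a N x + a x * dflux b N x
  - \sum_i F x 0 i * ((a x - a (x - h N *: e_ R i)) * (b x - b (x - h N *: e_ R i)) / h N).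
Proof.
rewrite /dflux !mulr_sumr -big_split /= -sumrB; apply: eq_bigr => i _.
by set c := (h N)^-1; ring.
Qed.

Lemma dflux_le a N x (L : R) : Omega x ->
  (forall i, `|a x - a (x - h N *: e_ R i)| <= L * h N) ->
  `|dflux a N x| <= n%:R * (MF * L).
Proof.
move=> Ox aL; apply: le_trans (ler_norm_sum _ _ _) _.
rewrite mulr_natl -[X in _ *+ X]card_ord -sumr_const; apply: ler_sum => i _.
rewrite normrM ler_pM ?FMF // normrM (@gtr0_norm _ _^-1) ?invr_gt0 ?mesh_gt0 //.
by rewrite ler_pdivrMr ?mesh_gt0.
Qed.

(** In the discrete Leibniz rule the factors bounded by 1 make the two costs add. The remaining term
    is a product of two differences divided by the mesh size, hence of order the mesh size by the
    bounds [cutoff_lip]. *)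
Lemma removableU E1 E2 (k1 k2 : R) : removable E1 k1 -> removable E2 k2 ->
  removable (E1 `|` E2) (k1 + k2).
Proof.
move=> [a [a01 [La aL] aB a0 ac]] [b [b01 [Lb bL] bB b0 bc]].
have a1 x : `|a x| <= 1 by have /andP[? ?] := a01 x; rewrite ger0_norm.
have b1 x : `|b x| <= 1 by have /andP[? ?] := b01 x; rewrite ger0_norm.
exists (fun x => a x * b x); split.
- move=> x; have /andP[? ?] := a01 x; have /andP[? ?] := b01 x.
  by rewrite mulr_ge0 //= mulr_ile1.
- exists (La + Lb); near=> N => x i.
  have -> : a x * b x - a (x - h N *: e_ R i) * b (x - h N *: e_ R i) =
    (a x - a (x - h N *: e_ R i)) * b x +
    a (x - h N *: e_ R i) * (b x - b (x - h N *: e_ R i)) by ring.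
  apply: le_trans (ler_normD _ _) _; rewrite [leRHS]mulrDl !normrM; apply: lerD.
    by rewrite -[leRHS]mulr1 ler_pM //; move: x i; near: N.
  by rewrite -[leRHS]mul1r ler_pM //; move: x i; near: N.
- by move=> x Bx; rewrite aB // bB // mulr1.
- move=> x [E1x|E2x] bx.
    by apply: filterS (a0 _ E1x bx) => y ->; rewrite mul0r.
  by apply: filterS (b0 _ E2x bx) => y ->; rewrite mulr0.
move=> e e0; have e3 : 0 < e / 3 by rewrite divr_gt0.
near=> N.
have h0 := mesh_gt0 M0 N.
have aLN : forall x i, `|a x - a (x - h N *: e_ R i)| <= La * h N by near: N.
have bLN : forall x i, `|b x - b (x - h N *: e_ R i)| <= Lb * h N by near: N.
apply: (@le_trans _ _ (mean M N (fun x => \1_Omega x * `|dflux a N x|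
    + \1_Omega x * `|dflux b N x| + e / 3))); last first.
  rewrite !meanD // mean_cst.
  have : mean M N (fun x => \1_Omega x * `|dflux a N x|) <= k1 + e / 3.
    by near: N; exact: ac.
  have : mean M N (fun x => \1_Omega x * `|dflux b N x|) <= k2 + e / 3.
    by near: N; exact: bc.
  by move: (mean _ _ _) (mean _ _ _) => A1 A2 ? ?; lra.
apply: le_mean => x; rewrite indicE.
case: (boolP (x \in Omega)) => [/set_mem Ox|_]; last by rewrite !mul0r !add0r ltW.
rewrite !mul1r dflux_mul (le_trans (ler_normB _ _)) // lerD //.
  apply: le_trans (ler_normD _ _) _; rewrite !normrM.
  by rewrite lerD // -[leRHS]mul1r ler_wpM2r.
apply: (@le_trans _ _ (n%:R * (MF * (La * Lb * h N)))).
  apply: le_trans (ler_norm_sum _ _ _) _.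
  rewrite mulr_natl -[X in _ *+ X]card_ord -sumr_const; apply: ler_sum => i _.
  rewrite normrM ler_pM ?FMF // normrM (@gtr0_norm _ _^-1) ?invr_gt0 //.
  rewrite ler_pdivrMr // normrM.
  by apply: le_trans (ler_pM _ _ (aLN x i) (bLN x i)) _ => //; rewrite mulrACA mulrA.
near: N.
have : (fun N => n%:R * (MF * (La * Lb * h N))) @ \oo --> (n%:R * (MF * (La * Lb * 0)) : R).
  by do 3 (apply: cvgM; first exact: cvg_cst); exact: mesh_cvg0.
rewrite !mulr0 => /cvgr0_norm_le/(_ _ e3).
by apply: filterS => N /(le_trans (ler_norm _)).
Unshelve. all: by end_near. Qed.

(** The cutoff rises from 0 at distance r from [y] to 1 at distance 2r. Its slope 1/r, the bound
    [MF] and a volume of order r^n give a cost of order r^(n-1). *)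
Lemma removable_ball y (r : R) : 0 < r -> (forall x, B x -> 2 * r <= `|x - y|) ->
  removable (ball y r) (n%:R * (MF / r) * (4 * r / M) ^+ n).
Proof.
move=> r0 By; pose a x := clamp (`|x - y| / r - 1).
have aL N x i : `|a x - a (x - h N *: e_ R i)| <= r^-1 * h N.
  apply: le_trans (clamp_lip _ _) _.
  rewrite opprB addrA subrK -mulrBl normrM (@gtr0_norm _ r^-1) ?invr_gt0 // mulrC.
  apply: ler_wpM2l; first by rewrite invr_ge0 ltW.
  apply: le_trans (ler_dist_dist _ _) _.
  by rewrite opprB addrA subrK opprB addrC subrK norm_scale_e gtr0_norm ?mesh_gt0.
have a1 x : 2 * r <= `|x - y| -> a x = 1.
  by move=> ?; rewrite /a clamp_eq1 // lerBrDr ler_pdivlMr // mulrDl mul1r -mulr2n -mulr_natl.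
exists a; split.
- by move=> x; exact: clamp01.
- by exists r^-1; near=> N => x i; exact: aL.
- by move=> x /By/a1.
- move=> x xy _; have : \forall x' \near x, ball y r x' by apply: open_nbhs_nbhs; split=> //; exact: ball_open.
  apply: filterS => x'; rewrite -ball_normE /= distrC => x'y.
  by rewrite /a clamp_eq0 // subr_le0 ler_pdivrMr // mul1r ltW.
move=> e e0; near=> N; have h0 := mesh_gt0 M0 N.
have hr : h N <= r.
  near: N; have /cvgr0_norm_le/(_ _ r0) := mesh_cvg0 M.
  by apply: filterS => N /(le_trans (ler_norm _)).
(* A backward difference sees one mesh step, at most [r], beyond the radius 2r where the cutoff
   becomes 1. *)
pose A := [set x | `|x - y| <= 3 * r].
apply: (@le_trans _ _ (mean M N (fun x => n%:R * (MF / r) * \1_A x))).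
  apply: le_mean => x; rewrite indicE.
  case: (boolP (x \in Omega)) => [/set_mem Ox|_]; last first.
    by rewrite mul0r mulr_ge0 // mulr_ge0 // divr_ge0 // ltW.
  rewrite mul1r; have [xA|xA] := boolP (`|x - y| <= 3 * r).
    by rewrite indicE mem_set // mulr1; apply: dflux_le => // i; exact: aL.
  rewrite -ltNge in xA.
  rewrite /dflux big1 ?normr0 ?mulr_ge0 ?invr_ge0 ?(ltW r0) // => i _.
  rewrite !a1 ?subrr ?mul0r ?mulr0 //; last by lra.
  have := lerB_dist (x - y) (h N *: e_ R i).
  by rewrite norm_scale_e gtr0_norm // addrAC => ?; lra.
rewrite meanZ; apply: (@le_trans _ _ (n%:R * (MF / r) * (4 * r / M) ^+ n)); last first.
  by rewrite lerDl ltW.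
rewrite ler_wpM2l ?mulr_ge0 ?invr_ge0 ?(ltW r0) //.
have r3 : 0 <= 3 * r by rewrite mulr_ge0 // ltW.
apply: le_trans (mean_cube (A := A) (y := y) M0 N r3 _) _; first by [].
rewrite lerXn2r ?nnegrE ?addr_ge0 ?mulr_ge0 ?invr_ge0 ?(ltW r0) ?(ltW M0) //.
(* The rounding term of the count is absorbed by r / M for large [N], which turns 3 into 4. *)
have -> : 4 * r / M = 3 * r / M + r / M by rewrite -mulrDl; congr (_ / _); ring.
rewrite lerD2l -[leRHS]invrK invf_div lef_pV2 ?posrE ?divr_gt0 //.
apply: (@le_trans _ _ N%:R); last by rewrite ler_nat ltnW.
by near: N; exact: nbhs_infty_ger.
Unshelve. all: by end_near. Qed.

End cutoff.

(** * Regular boundary points *)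

Section dot.
Variables (R : realType) (n : nat).
Implicit Types u w : 'rV[R]_n.

Lemma dotZr (c : R) u w : dot u (c *: w) = c * dot u w.
Proof. by rewrite mulr_sumr; apply: eq_bigr => i _; rewrite mxE mulrCA. Qed.

Lemma dot_ge0 u : 0 <= dot u u.
Proof. by apply: sumr_ge0 => i _; rewrite -expr2 sqr_ge0. Qed.

Lemma dot_gt0 u : u != 0 -> 0 < dot u u.
Proof.
move=> u0; rewrite lt_def dot_ge0 andbT; apply: contra u0.
rewrite psumr_eq0 => [|i _]; last by rewrite -expr2 sqr_ge0.
move=> /allP H; apply/eqP/rowP => i; rewrite mxE; apply/eqP.
by have := H i (mem_index_enum _); rewrite /= mulf_eq0 orbb.
Qed.

End dot.

Lemma near_pair_comp (T I J : Type) (F : set_system T) (G : set_system I)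
    (H : set_system J) (u : J -> I) (P : T -> I -> Prop) :
  u @ H `=>` G -> (\forall y \near F & t \near G, P y t) ->
  \forall y \near F & j \near H, P y (u j).
Proof.
move=> uG [[A C] [/= FA GC] AC]; exists (A, u @^-1` C) => /=.
  by split=> //; exact: uG.
by move=> [y j] /= [Ay Cj]; exact: (AC (y, u j)).
Qed.

Section regular.
Variables (R : realType) (n : nat) (M : R).
Hypothesis M0 : 0 < M.
Variables (Omega B : set 'rV[R]_n) (F : 'rV[R]_n -> 'rV[R]_n) (MF : R).
Hypothesis MF0 : 0 <= MF.
Hypothesis FMF : forall x i, Omega x -> `|F x 0 i| <= MF.
Hypothesis Fc : {within closure Omega, continuous F}.
Hypothesis Fn : forall x nu, bdry Omega x -> outward_unit_normal Omega x nu ->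
  dot (F x) nu = 0.

Local Notation h := (mesh M).

Lemma chart_bdry (U : set 'rV[R]_n) (phi : 'rV[R]_n -> R) x : U x -> open U ->
  C1_on U phi -> (forall y, U y -> (Omega y <-> phi y < 0)) -> bdry Omega x ->
  phi x = 0.
Proof.
move=> Ux Uo [phid _] side [clx nx].
apply/eqP; rewrite eq_le leNgt; apply/andP; split; last first.
  by by rewrite leNgt; apply/negP => /(side _ Ux).2.
apply/negP => phix; have phic := differentiable_continuous (phid _ Ux).
have /clx[y [Oy [/= Uy phiy]]] : \forall y \near x, U y /\ 0 < phi y.
  near=> y; split; near: y; first exact: open_nbhs_nbhs.
  exact: cvgr_gt phic _ phix.
by have := (side _ Uy).1 Oy; rewrite ltNge ltW.
Unshelve. all: by end_near. Qed.

(* The gradient of a defining function is parallel to the normal, so the normal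
   component of [F] is small near the boundary. *)
Lemma chart_flux_small (U K : set 'rV[R]_n) (phi : 'rV[R]_n -> R) (kappa : R) :
  open U -> C1_on U phi -> (forall y, U y -> (Omega y <-> phi y < 0)) ->
  (forall y, U y -> grad phi y != 0) ->
  compact K -> K `<=` U -> 0 < kappa ->
  \forall eps \near 0^'+, forall x, K x -> Omega x -> - (2 * eps) < phi x ->
    `|dot (F x) (grad phi x)| <= kappa.
Proof.
move=> Uo phiC1 side grad0 Kc KU k0; have [phid phic] := phiC1.
have /compact_near_coveringP := Kc => /(_ _ 0^'+ (fun eps x => Omega x ->
  - (2 * eps) < phi x -> `|dot (F x) (grad phi x)| <= kappa)).
apply=> x Kx; have Ux := KU _ Kx.
have phicx := differentiable_continuous (phid _ Ux).
have [clx|ncl] := pselect (closure Omega x); last first.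
  suff H : \forall y \near x, ~ Omega y.
    by near=> y eps; have nOy : ~ Omega y; [near: y | move=> /nOy].
  move/existsNP: ncl => [V /not_implyP[Vx /nonemptyPn VO]].
  by apply: filterS Vx => y Vy Oy; have : (Omega `&` V) y by []; rewrite VO.
(* Near an interior point [phi] stays below phi(x) / 2 < 0, so the layer phi > -2 eps misses a
   neighbourhood of it once [eps] is small. *)
have [Ox|nOx] := pselect (Omega x).
  have phix : phi x < 0 by apply/side.
  near=> y eps.
  have H1 : phi y <= phi x / 2 by near: y; apply: (cvgr_le _ phicx); lra.
  have H2 : eps <= - phi x / 4 by near: eps; apply: nbhs_right_le; lra.
  by move=> _ /= H3; exfalso; lra.
have bx : bdry Omega x by [].
have G0 : dot (F x) (grad phi x) = 0.
  have phix : phi x = 0 := chart_bdry Ux Uo phiC1 side bx.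
  (* [phi] is a defining function at every boundary point of [U], so its normalised gradient is an
     admissible normal at [x]. *)
  have := Fn bx (ex_intro _ U (ex_intro _ phi (And4 Uo Ux phiC1
    (And4 side phix (grad0 _ Ux) erefl)))).
  move/eqP; rewrite dotZr mulf_eq0 invr_eq0 /enorm sqrtr_eq0 leNgt dot_gt0 ?grad0 //=.
  by move/eqP.
have Gc : dot (F y) (grad phi y) @[y --> within (closure Omega) (nbhs x)] --> (0 : R).
  rewrite -G0 /dot; apply: cvg_big => [|i _]; first exact: add_continuous.
  apply: cvgM.
    have /subspace_continuousP/(_ x clx) Fx := Fc.
    exact: (cvg_comp _ _ Fx (@coord_continuous _ _ _ 0 i (F x))).
  have gc : {for x, continuous ('D_(e_ R i) phi)}.
    by have := phic (e_ R i); rewrite continuous_open_subspace //; apply; exact: mem_set.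
  rewrite mxE; apply: (@cvg_trans _ ('D_(e_ R i) phi y @[y --> within (closure Omega) (nbhs x)])).
    by apply: near_eq_cvg; apply: nearW => y; rewrite mxE.
  by apply: cvg_within_filter; exact: gc.
have /cvgr0_norm_le/(_ _ k0) := Gc; rewrite near_withinE => H.
near=> y eps.
have H1 : closure Omega y -> `|dot (F y) (grad phi y)| <= kappa by near: y; exact: H.
by move=> /(@subset_closure _ _ _)/H1.
Unshelve. all: by end_near.
Qed.

Lemma C1_onW (V : normedModType R) (A A' : set 'rV[R]_n) (f : 'rV[R]_n -> V) :
  A' `<=` A -> C1_on A f -> C1_on A' f.
Proof.
move=> AA' [df cf]; split=> [x /AA'/df//|u].
exact: continuous_subspaceW AA' (cf u).
Qed.

Lemma C1_on_continuous (V : normedModType R) (A : set 'rV[R]_n)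
    (f : 'rV[R]_n -> V) u x :
  open A -> C1_on A f -> A x -> {for x, continuous ('D_u f)}.
Proof.
move=> Ao [_ /(_ u)]; rewrite continuous_open_subspace // => cf Ax.
by apply: cf; exact: mem_set.
Qed.

(** Some partial derivative of [phi] is nonzero at [z], and by continuity keeps half of its modulus
    on a ball. The coordinate direction [k] is thus uniformly transversal to the level sets, which
    bounds the thickness of layers between them. *)
Lemma regular_chart z : regular_bdry Omega z -> exists r (phi : 'rV[R]_n -> R) k (G c : R),
  [/\ 0 < r, C1_on (ball z r) phi,
      forall y, ball z r y -> (Omega y <-> phi y < 0) &
      [/\ forall y i, ball z r y -> `|'D_(e_ R i) phi y| <= G,
      0 < c,
      forall y, ball z r y -> c <= `|'D_(e_ R k) phi y| &
      forall y, ball z r y -> grad phi y != 0]].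
Proof.
move=> [bz [nu [U [phi [Uo Uz phiC1 [side _ gz _]]]]]].
have [k dk] : exists k, grad phi z 0 k != 0 by exact/rV0Pn.
have cphi i : {for z, continuous ('D_(e_ R i) phi)} by exact: C1_on_continuous Uz.
pose G := \sum_i `|'D_(e_ R i) phi z| + 1.
set d := grad phi z 0 k in dk; have d0 : 0 < `|d| by rewrite normr_gt0.
have /nbhs_ballP[r /= r0 H] : \forall y \near z, [/\ U y,
    forall i, `|'D_(e_ R i) phi y| <= G & `|d| / 2 <= `|'D_(e_ R k) phi y|].
  near=> y; split.
  - by near: y; exact: open_nbhs_nbhs.
  - near: y; apply: filter_forall => i; near=> y.
    apply: (@le_trans _ _ (`|'D_(e_ R i) phi z| + 1)); last first.
      by rewrite lerD2r (bigD1 i) //= lerDl sumr_ge0.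
    rewrite -lerBlDl (le_trans (lerB_dist _ _)) // distrC.
    near: y; exact: (@cvgr_dist_le _ _ _ _ _ _ _ (cphi i) _ ltr01).
  - have : `|'D_(e_ R k) phi z - 'D_(e_ R k) phi y| <= `|d| / 2.
      near: y; apply: (@cvgr_dist_le _ _ _ _ _ _ _ (cphi k)); exact: divr_gt0.
    have := lerB_dist ('D_(e_ R k) phi z) ('D_(e_ R k) phi y).
    have -> : 'D_(e_ R k) phi z = d by rewrite /d mxE.
    lra.
exists r, phi, k, G, (`|d| / 2); split=> //.
- by apply: C1_onW phiC1 => y /H[].
- by move=> y /H[Uy _ _]; exact: side.
split; [by move=> y i /H[_ + _]; exact | exact: divr_gt0 | by move=> y /H[] |].
move=> y /H[_ _ dy]; apply/rV0Pn; exists k; rewrite mxE -normr_gt0.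
by apply: lt_le_trans dy; exact: divr_gt0.
Unshelve. all: by end_near. Qed.

(* On a segment in direction [k] the level of [phi] varies at least at rate [c]. *)
Lemma mean_layer z r (phi : 'rV[R]_n -> R) k (c eps s : R) N :
  0 < c -> 0 < eps -> s < r ->
  C1_on (ball z r) phi ->
  (forall y, ball z r y -> c <= `|'D_(e_ R k) phi y|) ->
  mean M N \1_([set x | `|x - z| <= s /\ - (2 * eps) < phi x < 0]) <=
    2 * eps / c / (2 * M) + N.+2%:R^-1.
Proof.
move=> c0 eps0 sr [phid _] dphi.
apply: (@mean_slab _ _ _ M0 N k); first by rewrite divr_ge0 ?mulr_ge0 // ltW.
move=> x y [xz /andP[x1 x2]] [yz /andP[y1 y2]] xy.
set t := x 0 k - y 0 k.
have xE : x = y + t *: e_ R k.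
  apply/rowP => j; rewrite !mxE eqxx /=; case: eqP => [->|/eqP jk].
    by rewrite mulr1 /t addrC subrK.
  by rewrite mulr0 addr0 xy.
have inb (u : R) : 0 <= u <= 1 -> ball z r (y + (u * t) *: e_ R k).
  move=> /andP[u0 u1]; rewrite -ball_normE /= distrC; apply: le_lt_trans sr.
  have -> : y + (u * t) *: e_ R k - z = (1 - u) *: (y - z) + u *: (x - z).
    rewrite [X in u *: (X - z)]xE -scalerA; apply/rowP => j; rewrite !mxE.
    by move: (y 0 j) (t * _) (z 0 j) => ? ? ?; ring.
  apply: le_trans (ler_normD _ _) _; rewrite !normrZ (ger0_norm u0) ger0_norm ?subr_ge0 //.
  have := ler_wpM2l u0 xz; have : 0 <= 1 - u by rewrite subr_ge0.
  by move=> /ler_wpM2l/(_ _ _ yz); lra.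
have [u u01 E] : exists2 u : R, 0 <= u <= 1 &
    phi x - phi y = t * 'D_(e_ R k) phi (y + (u * t) *: e_ R k).
  by rewrite {1}xE; apply: dir_MVT => u /inb/phid/diff_derivable.
have : `|phi x - phi y| <= 2 * eps by rewrite ler_norml; apply/andP; split; lra.
rewrite E normrM => tE; rewrite ler_pdivlMr //; apply: le_trans tE.
by rewrite ler_wpM2l // dphi //; exact: inb.
Qed.

Lemma closed_ball_rV_compact z (r : R) : 0 < r ->
  compact [set x : 'rV[R]_n | `|x - z| <= r].
Proof.
move=> r0; have -> : [set x | `|x - z| <= r] = closed_ball z r.
  by rewrite closed_ballE //; apply/seteqP; split=> x; rewrite /closed_ball_ /= distrC.
apply: bounded_closed_compact; last exact: closed_ball_closed.
exists (`|z| + r); split; first exact: num_real.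
move=> A zA x /=; rewrite closed_ballE // /closed_ball_ /= => xz.
rewrite -(subKr z x) (le_trans (ler_normB _ _)) //.
by apply: le_trans (ltW zA); rewrite lerD2l.
Qed.

Lemma sum_F_le (d : 'I_n -> R) x (L : R) : Omega x -> (forall i, `|d i| <= L) ->
  `|\sum_i F x 0 i * d i| <= n%:R * (MF * L).
Proof.
move=> Ox dL; apply: le_trans (ler_norm_sum _ _ _) _.
rewrite mulr_natl -[X in _ *+ X]card_ord -sumr_const; apply: ler_sum => i _.
by rewrite normrM ler_pM ?FMF.
Qed.

(** The cutoff is 1 - theta * g(phi): [theta] localises to the ball of radius 2s, and g(phi) is 1
    near the boundary and 0 below the level -2 eps. Its gradient has a part along grad phi, of size
    1/eps but nearly orthogonal to [F], and a part from [theta], of size 1/s; both live on the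
    layer, whose mean is at most about eps / (c M). The radius [s] does not depend on [kappa], so a
    finite subcover can be fixed before the costs are. *)
Lemma removable_regular z : regular_bdry Omega z ->
  (exists2 rho : R, 0 < rho & forall x, B x -> rho <= `|x - z|) ->
  exists2 s : R, 0 < s &
    forall kappa : R, 0 < kappa -> removable M Omega B F (ball z s) kappa.
Proof.
move=> /regular_chart[r [phi [k [G [c [r0 phiC1 side [phiG c0 phik grad0]]]]]]].
move=> [rho rho0 Brho]; have phid := phiC1.1.
(* r / 5 keeps the ball of radius 3s inside the chart; rho / 2 makes [theta], which vanishes from
   distance 2s on, vanish on [B]. *)
pose s := Num.min (r / 5) (rho / 2).
have s0 : 0 < s by rewrite lt_min !divr_gt0.
have sr : 3 * s < r.
  suff : s <= r / 5 by lra.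
  by rewrite ge_min lexx.
have srho : 2 * s <= rho.
  suff : s <= rho / 2 by lra.
  by rewrite ge_min lexx orbT.
exists s => // kappa kappa0.
pose K := [set x : 'rV[R]_n | `|x - z| <= 3 * s].
have Kc : compact K by apply: closed_ball_rV_compact; exact: mulr_gt0.
have KU : K `<=` ball z r.
  by move=> x xz; rewrite -ball_normE /= distrC; exact: le_lt_trans sr.
have G0 : 0 <= G by exact: le_trans (normr_ge0 _) (phiG z k (ballxx _ r0)).
(* With a layer of mean about eps / (c M), [kappa'] makes (4 / eps) * kappa' contribute kappa / 2,
   and [eps1] makes the slope of [theta] contribute at most kappa / 2. The + 1 guards against n * MF
   = 0. *)
pose kappa' := kappa * c * M / 8.
have kappa'0 : 0 < kappa' by rewrite divr_gt0 ?mulr_gt0.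
pose eps1 := kappa * s * c * M / (2 * (n%:R * MF + 1)).
have nMF : 0 <= n%:R * MF by rewrite mulr_ge0.
have eps10 : 0 < eps1 by rewrite divr_gt0 ?mulr_gt0 // ltr_wpDl.
have [eps [eps0 epsle small]] : exists eps : R, [/\ 0 < eps, eps <= eps1 &
    forall x, K x -> Omega x -> - (2 * eps) < phi x ->
      `|dot (F x) (grad phi x)| <= kappa'].
  near (0 : R)^'+ => eps; exists eps; split.
  - by near: eps; exact: nbhs_right_gt.
  - by near: eps; exact: nbhs_right_le.
  - near: eps; apply: chart_flux_small Kc KU kappa'0 => //; exact: ball_open.
(* [lev] is 0 at -eps and 1 at -2 eps, so [g] is 1 above -eps, which includes a neighbourhood of the
   boundary, and 0 below -2 eps. *)
pose lev t := - t / eps - 1.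
pose g t : R := smoothstep (lev t); pose dg t := dsmoothstep (lev t) * - eps^-1.
have levP (t : R) : is_derive t 1 lev (- eps^-1).
  have H1 : is_derive t 1 (fun u : R => (- eps^-1) * u) (- eps^-1).
    have := is_deriveZ (- eps^-1) (is_derive_id t (1 : R)).
    by rewrite [_ *: 1]mulr1.
  have := is_deriveB H1 (is_derive_cst (1 : R) t (1 : R)); rewrite subr0.
  rewrite (_ : _ - _ = lev) //; apply/funext => u.
  by rewrite /lev !fctE; ring.
have gP (t : R) : is_derive t 1 g (dg t).
  exact: is_derive1_comp (is_derive_smoothstep _) (levP t).
have levc : continuous lev.
  by move=> t; have [/derivable1_diffP/differentiable_continuous] := levP t.
pose theta x := clamp (2 - `|x - z| / s).
have thetaL N x i : `|theta x - theta (x - h N *: e_ R i)| <= s^-1 * h N.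
  apply: le_trans (clamp_lip _ _) _.
  have -> u w : 2 - u / s - (2 - w / s) = s^-1 * (w - u) by ring.
  rewrite normrM (@gtr0_norm _ s^-1) ?invr_gt0 //.
  apply: ler_wpM2l; first by rewrite invr_ge0 ltW.
  apply: le_trans (ler_dist_dist _ _) _.
  have -> : x - h N *: e_ R i - z - (x - z) = - (h N *: e_ R i).
    by rewrite opprB addrA subrK addrAC subrr add0r.
  by rewrite normrN norm_scale_e gtr0_norm ?mesh_gt0.
have theta0 x : 2 * s <= `|x - z| -> theta x = 0.
  by move=> ?; rewrite /theta clamp_eq0 // subr_le0 ler_pdivlMr.
pose b x := g (phi x); pose db i x := dg (phi x) * 'D_(e_ R i) phi x.
have b1 x : `|b x| <= 1.
  by have /andP[? ?] := smoothstep01 (lev (phi x)); rewrite ger0_norm.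
have t1 x : `|theta x| <= 1.
  by have /andP[? ?] := clamp01 (2 - `|x - z| / s); rewrite ger0_norm.
(* Near orthogonality concerns the exact gradient of [phi], so the differences of [b] must agree
   with its derivatives up to o(h), uniformly on [K]; compactness gives this. *)
have bunif (e1 : R) : 0 < e1 -> \forall N \near \oo, forall x, K x -> forall i,
    `|b x - b (x - h N *: e_ R i) - h N * db i x| <= e1 * h N.
  move=> e10.
  suff H i : \forall N \near \oo, forall x, K x ->
      `|b x - b (x - h N *: e_ R i) - h N * db i x| <= e1 * h N.
    near=> N.
    have HN : forall i x, K x ->
      `|b x - b (x - h N *: e_ R i) - h N * db i x| <= e1 * h N.
      by near: N; exact: filter_forall.
    by move=> x Kx i; exact: HN.
  have /compact_near_coveringP := Kc => /(_ _ \oo (fun N x =>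
    `|b x - b (x - h N *: e_ R i) - h N * db i x| <= e1 * h N)); apply=> x Kx.
  have bd : \forall y \near x, is_derive y (e_ R i) b (db i y).
    have : \forall y \near x, ball z r y.
      by apply: open_nbhs_nbhs; split; [exact: ball_open | exact: KU].
    apply: filterS => y /phid phiy.
    by apply: is_derive_chain => //; exact: differentiable_is_derive.
  have dbc : {for x, continuous (db i)}.
    have phicx := differentiable_continuous (phid _ (KU _ Kx)).
    apply: (@continuousM _ _ (dg \o phi) ('D_(e_ R i) phi)); last first.
      by apply: C1_on_continuous phiC1 (KU _ Kx); exact: ball_open.
    apply: (@continuous_comp _ _ _ phi dg) => //.
    apply: (@continuousM _ _ (fun t => dsmoothstep (lev t)) (fun=> - eps^-1)); last exact: cvg_cst.
    apply: (@continuous_comp _ _ _ lev (@dsmoothstep R)); first exact: levc.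
    exact: continuous_dsmoothstep.
  have hN : (fun N => - h N) @ \oo --> (0 : R).
    by rewrite -oppr0; apply: cvgN; exact: mesh_cvg0.
  apply: filterS (near_pair_comp hN (near_dir_diff e10 bd dbc)) => -[y N] /=.
  rewrite normrN (gtr0_norm (mesh_gt0 M0 N)) scaleNr mulNr.
  have -> : b y - b (y - h N *: e_ R i) - h N * db i y =
    - (b (y - h N *: e_ R i) - b y - - (h N * db i y)) by ring.
  by rewrite normrN.
have db_le x i : K x -> `|db i x| <= 4 / eps * G.
  move=> Kx; rewrite normrM ler_pM ?phiG //; last exact: KU.
  rewrite normrM normrN (@gtr0_norm _ eps^-1) ?invr_gt0 //.
  by rewrite ler_wpM2r ?dsmoothstep_le4 // invr_ge0 ltW.
have lev2 t : t <= - (2 * eps) -> 1 <= lev t.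
  by move=> ?; rewrite lerBrDr ler_pdivlMr // mulrDl mul1r; lra.
pose A := [set x : 'rV[R]_n | `|x - z| <= 3 * s /\ - (2 * eps) < phi x < 0].
have inA x : K x -> Omega x -> - (2 * eps) < phi x -> \1_A x = 1 :> R.
  move=> Kx Ox phi2; rewrite indicE mem_set //; split=> //; rewrite phi2 /=.
  by apply/side => //; exact: KU.
have dbF x : K x -> Omega x -> `|\sum_i F x 0 i * db i x| <=
    \1_A x * (4 / eps * kappa').
  move=> Kx Ox.
  have -> : \sum_i F x 0 i * db i x = dg (phi x) * dot (F x) (grad phi x).
    by rewrite mulr_sumr; apply: eq_bigr => i _; rewrite /db mxE mulrCA.
  have [phi2|phi2] := ltP (- (2 * eps)) (phi x).
    rewrite inA // mul1r normrM ler_pM ?small //.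
    rewrite normrM normrN (@gtr0_norm _ eps^-1) ?invr_gt0 //.
    by rewrite ler_wpM2r ?dsmoothstep_le4 // invr_ge0 ltW.
  rewrite /dg dsmoothstep_ge1 ?lev2 // !mul0r normr0 mulr_ge0 // mulr_ge0 ?(ltW kappa'0) //.
  by rewrite divr_ge0 // ltW.
have bF x : K x -> Omega x ->
  b x <= \1_A x.
  move=> Kx Ox.
  have [phi2|phi2] := ltP (- (2 * eps)) (phi x).
    by rewrite inA //; exact: le_trans (ler_norm _) (b1 x).
  by rewrite /b /g smoothstep_ge1 ?lev2.
have near_hs : \forall N \near \oo, h N <= s.
  have /cvgr0_norm_le/(_ _ s0) := mesh_cvg0 M.
  by apply: filterS => N /(le_trans (ler_norm _)).
have outK N x i : h N <= s -> ~ K x -> theta x = 0 /\ theta (x - h N *: e_ R i) = 0.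
  move=> hs /negP; rewrite -ltNge => xK; split; apply: theta0; first by lra.
  have := lerB_dist (x - z) (h N *: e_ R i).
  by rewrite norm_scale_e gtr0_norm ?mesh_gt0 // addrAC => ?; lra.
exists (fun x => 1 - theta x * b x); split.
- move=> x; have /andP[? ?] := clamp01 (2 - `|x - z| / s).
  have /andP[? ?] := smoothstep01 (lev (phi x)).
  by rewrite subr_ge0 mulr_ile1 //= gerBl mulr_ge0.
- exists (s^-1 + (1 + 4 / eps * G)); near=> N => x i.
  have hs : h N <= s by near: N.
  have h0 := mesh_gt0 M0 N.
  have -> : 1 - theta x * b x - (1 - theta (x - h N *: e_ R i) * b (x - h N *: e_ R i)) =
    - ((theta x - theta (x - h N *: e_ R i)) * b x + theta (x - h N *: e_ R i) *
       (b x - b (x - h N *: e_ R i))) by ring.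
  have [Kx|/(outK _ _ i hs)[-> ->]] := pselect (K x); last first.
    rewrite subrr !mul0r addr0 oppr0 normr0 mulr_ge0 ?(ltW h0) //.
    by rewrite !addr_ge0 ?invr_ge0 ?(ltW s0) // mulr_ge0 // divr_ge0 // ltW.
  rewrite normrN; apply: le_trans (ler_normD _ _) _; rewrite [leRHS]mulrDl.
  rewrite (normrM (theta x - _)) (normrM (theta _)).
  apply: lerD; first by rewrite -[leRHS]mulr1 ler_pM ?thetaL ?b1.
  rewrite -[leRHS]mul1r ler_pM // -[X in `|X|](subrK (h N * db i x)).
  apply: le_trans (ler_normD _ _) _; rewrite mulrDl; apply: lerD.
    by move: (x) (Kx) i; near: N; exact: bunif.
  by rewrite normrM (gtr0_norm h0) mulrC ler_wpM2r ?db_le // ltW.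
- by move=> x /Brho ?; rewrite theta0 ?mul0r ?subr0 //; lra.
- move=> x xz bx; have zrx : ball z r x.
    by apply: le_ball xz; lra.
  have phix0 : phi x = 0 by exact: chart_bdry zrx (ball_open _ _) phiC1 side bx.
  have phicx := differentiable_continuous (phid _ zrx).
  near=> y.
  have yz : ball z s y by near: y; apply: open_nbhs_nbhs; split => //; exact: ball_open.
  have phiy : - eps < phi y.
    by near: y; apply: (cvgr_gt _ phicx); rewrite phix0 oppr_lt0.
  rewrite /theta clamp_eq1; last first.
    rewrite lerBrDr addrC -lerBrDr ler_pdivrMr // -[2]/(1 + 1) addrK mul1r.
    by move: yz; rewrite -ball_normE /= distrC; exact: ltW.
  rewrite /b /g smoothstep_le0 ?mulr1 ?subrr //.
  by rewrite subr_le0 ler_pdivrMr // mul1r lerNl ltW.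
move=> e e0.
(* [Q] collects the two bounds on the layer that do not tend to 0 with the mesh. *)
pose Q := 4 / eps * kappa' + n%:R * (MF * s^-1).
have Q0 : 0 <= Q.
  by rewrite addr_ge0 // !mulr_ge0 // ?invr_ge0 ltW.
pose e1 := e / 4 / (n%:R * MF + 1).
have e10 : 0 < e1 by rewrite !divr_gt0 // ltr_wpDl.
near=> N.
have h0 := mesh_gt0 M0 N.
have hs : h N <= s by near: N.
have bN : forall x, K x -> forall i,
    `|b x - b (x - h N *: e_ R i) - h N * db i x| <= e1 * h N.
  by near: N; exact: bunif.
have hsmall : n%:R * (MF * (s^-1 * h N * (4 / eps * G))) <= e / 4.
  near: N; have e4 : 0 < e / 4 by rewrite divr_gt0.
  have : (fun N => n%:R * (MF * (s^-1 * h N * (4 / eps * G)))) @ \oo -->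
      (n%:R * (MF * (s^-1 * 0 * (4 / eps * G))) : R).
    do 2 (apply: cvgM; first exact: cvg_cst); apply: cvgM; last exact: cvg_cst.
    by apply: cvgM; [exact: cvg_cst | exact: mesh_cvg0].
  rewrite mulr0 mul0r !mulr0 => /cvgr0_norm_le/(_ _ e4).
  by apply: filterS => N /(le_trans (ler_norm _)).
have Nsmall : Q * N.+2%:R^-1 <= e / 2.
  rewrite ler_pdivrMr // mulrC -ler_pdivrMr ?divr_gt0 //.
  apply: (@le_trans _ _ N%:R); last by rewrite ler_nat ltnW.
  by near: N; exact: nbhs_infty_ger.
have QA x : 0 <= Q * \1_A x + e / 2.
  by apply: addr_ge0; [rewrite mulr_ge0 // indicE | rewrite divr_ge0 // ltW].
apply: (@le_trans _ _ (mean M N (fun x => Q * \1_A x + e / 2))).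
  apply: le_mean => x; rewrite [X in X * _]indicE.
  case: (boolP (x \in Omega)) => [/set_mem Ox|_]; last first.
    by rewrite mul0r.
  rewrite mul1r.
  have [Kx|nKx] := pselect (K x); last first.
    rewrite /dflux big1 ?normr0 // => i _.
    by have [-> ->] := outK N x i hs nKx; rewrite !mul0r subr0 subrr mul0r mulr0.
  (* Leibniz rule with the difference of [b] replaced by its derivative: the slope of [theta]
     against [b], the error of this replacement, a second-order cross term, and [theta] times F .
     grad b. The outer two live on the layer; the middle two are at most e / 4 each. *)
  have -> : dflux M F (fun x => 1 - theta x * b x) N x =
    - (b x * (\sum_i F x 0 i * ((theta x - theta (x - h N *: e_ R i)) / h N))
      + \sum_i F x 0 i * (theta (x - h N *: e_ R i) *
           ((b x - b (x - h N *: e_ R i) - h N * db i x) / h N))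
      - \sum_i F x 0 i * ((theta x - theta (x - h N *: e_ R i)) * db i x)
      + theta x * \sum_i F x 0 i * db i x).
    rewrite !mulr_sumr -sumrN -!big_split -sumrN; apply: eq_bigr => i _ /=.
    by field; rewrite gt_eqF.
  rewrite normrN; apply: le_trans (ler_normD _ _) _.
  apply: le_trans (lerD (ler_normB _ _) (lexx _)) _.
  apply: le_trans (lerD (lerD (ler_normD _ _) (lexx _)) (lexx _)) _.
  have S1 : `|b x * (\sum_i F x 0 i * ((theta x - theta (x - h N *: e_ R i)) / h N))|
      <= \1_A x * (n%:R * (MF * s^-1)).
    rewrite normrM ler_pM //.
      apply: le_trans (bF _ Kx Ox); rewrite ger0_norm //.
      by have /andP[] := smoothstep01 (lev (phi x)).
    apply: sum_F_le => // i; rewrite normrM (@gtr0_norm _ (h N)^-1) ?invr_gt0 //.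
    by rewrite ler_pdivrMr.
  have S2 : `|\sum_i F x 0 i * (theta (x - h N *: e_ R i) *
           ((b x - b (x - h N *: e_ R i) - h N * db i x) / h N))| <= e / 4.
    apply: (@le_trans _ _ (n%:R * (MF * e1))).
      apply: sum_F_le => // i; rewrite normrM -[leRHS]mul1r ler_pM //.
      rewrite normrM (@gtr0_norm _ (h N)^-1) ?invr_gt0 //.
      by rewrite ler_pdivrMr // bN.
    have -> : n%:R * (MF * e1) = e / 4 * (n%:R * MF / (n%:R * MF + 1)).
      by rewrite /e1; move: (n%:R * MF + 1)^-1 => ?; ring.
    rewrite -[leRHS]mulr1 ler_wpM2l ?divr_ge0 ?(ltW e0) //.
    by rewrite ler_pdivrMr ?ltr_wpDl // mul1r lerDl.
  have S3 : `|\sum_i F x 0 i * ((theta x - theta (x - h N *: e_ R i)) * db i x)| <= e / 4.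
    apply: le_trans hsmall; apply: sum_F_le => // i.
    by rewrite normrM ler_pM // db_le.
  have S4 : `|theta x * \sum_i F x 0 i * db i x| <= \1_A x * (4 / eps * kappa').
    rewrite normrM -[leRHS]mul1r ler_pM //; exact: dbF.
  have -> : Q * \1_A x + e / 2 = \1_A x * (n%:R * (MF * s^-1)) + e / 4 + e / 4
      + \1_A x * (4 / eps * kappa') by rewrite /Q; field; rewrite !gt_eqF.
  exact: lerD (lerD (lerD S1 S2) S3) S4.
rewrite meanD mean_cst // meanZ [leRHS](_ : _ = kappa + e / 2 + e / 2); last by field.
rewrite lerD2r; apply: (@le_trans _ _ (Q * (2 * eps / c / (2 * M) + N.+2%:R^-1))).
  by rewrite ler_wpM2l ?Q0 //; exact: (mean_layer N c0 eps0 sr phiC1 phik).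
rewrite [leLHS]mulrDr; apply: lerD; last by [].
have -> : Q * (2 * eps / c / (2 * M)) =
    4 * kappa' / (c * M) + (n%:R * MF) * eps / (s * c * M).
  by rewrite /Q; field; rewrite !gt_eqF.
rewrite [leRHS](splitr kappa); apply: lerD.
  by rewrite /kappa' le_eqVlt; apply/orP; left; apply/eqP; field; rewrite !gt_eqF.
rewrite ler_pdivrMr ?mulr_gt0 //; apply: le_trans (ler_wpM2l nMF epsle) _.
have -> : n%:R * MF * eps1 = kappa / 2 * (s * c * M) * (n%:R * MF / (n%:R * MF + 1)).
  by rewrite /eps1; field; rewrite gt_eqF // ltr_wpDl.
rewrite -[leRHS]mulr1 ler_wpM2l ?mulr_ge0 ?(ltW kappa0) ?(ltW s0) ?(ltW c0) ?(ltW M0) //.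
by rewrite ler_pdivrMr ?ltr_wpDl // mul1r lerDl.
Unshelve. all: by end_near.
Qed.

End regular.

(** * The singular set and the whole boundary *)

Section hausdorff_null.
Variables (R : realType) (n : nat).
Implicit Types (A U : set 'rV[R]_n).

Lemma norm_le_enorm (u : 'rV[R]_n) : `|u| <= enorm u.
Proof.
apply/rV_norm_leP => [|i]; first exact: sqrtr_ge0.
rewrite -sqrtr_sqr; apply: ler_wsqrtr; rewrite /dot (bigD1 i) //= expr2 lerDl.
by apply: sumr_ge0 => j _; rewrite -expr2 sqr_ge0.
Qed.

Lemma le_diam U x y : U x -> U y -> ((enorm (x - y))%:E <= diam U)%E.
Proof. by move=> Ux Uy; apply: ereal_sup_ubound; exists x, y. Qed.

(** A null supremum over [delta] makes every pre-measure null, so sets of diameter at most [delta]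
    with small total weight cover [A]; the weights are returned as reals. Diameters are given for
    nonempty sets only, that of the empty set being -oo. *)
Lemma hausdorff_null_cover (s : nat) A (delta e : R) : hausdorff s A = 0%E ->
  0 < delta -> 0 < e -> exists (U : nat -> set 'rV[R]_n) (w : nat -> R),
  [/\ A `<=` \bigcup_k U k,
      forall K, \sum_(k < K) w k <= e,
      forall k, 0 <= w k &
      forall k, U k !=set0 -> exists d : R, [/\ 0 <= d, d <= delta, w k = d ^+ s &
        forall x y, U k x -> U k y -> `|x - y| <= d]].
Proof.
move=> H0 d0 e0.
have : (hausdorff_pre s delta A < e%:E)%E.
  apply: (@le_lt_trans _ _ 0%E); last by rewrite lte_fin.
  by rewrite -H0; apply: ereal_sup_ubound; exists delta.
move=> /ereal_inf_lt[_ [U [AU Ud ->]] Ue].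
have dE k : U k !=set0 -> exists d : R, [/\ 0 <= d, d <= delta & diam (U k) = d%:E].
  move=> [x Ux].
  have d1 : (0 <= diam (U k))%E.
    by apply: le_trans (le_diam Ux Ux); rewrite lee_fin sqrtr_ge0.
  have dfin : diam (U k) \is a fin_num.
    by rewrite ge0_fin_numE // (le_lt_trans (Ud k)) // ltry.
  exists (fine (diam (U k))); rewrite fineK //; split=> //; first exact: fine_ge0.
  by rewrite -lee_fin fineK.
have w0 k : (0 <= hausdorff_weight s (U k))%E.
  rewrite /hausdorff_weight; case: ifPn => // /set0P/dE[d [dp _ ->]].
  by rewrite -EFin_expe lee_fin exprn_ge0.
have wfin k : hausdorff_weight s (U k) \is a fin_num.
  rewrite /hausdorff_weight; case: ifPn => // /set0P/dE[d [dp _ ->]].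
  by rewrite -EFin_expe.
exists U, (fun k => fine (hausdorff_weight s (U k))); split=> //.
- move=> K; rewrite -lee_fin -sumEFin; apply: le_trans (ltW Ue).
  rewrite (eq_bigr (fun k : 'I_K => hausdorff_weight s (U k))) => [|k _]; last exact: fineK.
  rewrite -(big_mkord xpredT (fun k => hausdorff_weight s (U k))).
  exact: nneseries_lim_ge.
- by move=> k; exact: fine_ge0.
move=> k Uk; have [d [dp dd dE']] := dE _ Uk; exists d; split=> //.
  rewrite /hausdorff_weight; case: ifPn => [/eqP U0|_]; first by case: Uk => x; rewrite U0.
  by rewrite dE' -EFin_expe.
move=> x y Ux Uy; apply: le_trans (norm_le_enorm _) _.
by rewrite -lee_fin -dE' le_diam.
Qed.

End hausdorff_null.

Section boundary.
Variables (R : realType) (n : nat) (M : R).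
Hypotheses (n_gt0 : (0 < n)%N) (M0 : 0 < M).
Variables (Omega B : set 'rV[R]_n) (F : 'rV[R]_n -> 'rV[R]_n) (MF : R).
Hypothesis MF0 : 0 <= MF.
Hypothesis FMF : forall x i, Omega x -> `|F x 0 i| <= MF.
Hypothesis Fc : {within closure Omega, continuous F}.
Hypothesis Fn : forall x nu, bdry Omega x -> outward_unit_normal Omega x nu ->
  dot (F x) nu = 0.
Hypothesis Oo : open Omega.
Hypothesis OM : forall x, Omega x -> `|x| < M.
Hypothesis Hnull : hausdorff n.-1 (bdry Omega `\` regular_bdry Omega) = 0%E.
Variable rho : R.
Hypothesis rho0 : 0 < rho.
Hypothesis Brho : forall x y, B x -> bdry Omega y -> rho <= `|x - y|.

Lemma compact_closure : compact (closure Omega).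
Proof.
apply: bounded_closed_compact; last exact: closed_closure.
exists M; split; first exact: num_real.
move=> A MA x /= clx; apply: le_trans (ltW MA).
have cM : closed [set y : 'rV[R]_n | `|y - 0| <= M].
  apply: compact_closed; first exact: norm_hausdorff.
  exact: closed_ball_rV_compact.
rewrite -[x]subr0; apply: cM.
by apply: closureS clx => y /OM/ltW; rewrite /= subr0.
Qed.

Lemma compact_bdry : compact (bdry Omega).
Proof.
apply: (subclosed_compact _ compact_closure); last by move=> x [].
by rewrite /bdry setDE; apply: closedI; [exact: closed_closure | exact: open_closedC].
Qed.

Lemma removable_bigU (I : Type) (E : I -> set 'rV[R]_n) (c : I -> R) (s : seq I) :
  (forall i, removable M Omega B F (E i) (c i)) ->
  removable M Omega B F (\big[setU/set0]_(i <- s) E i) (\sum_(i <- s) c i).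
Proof.
move=> H; elim: s => [|i s IHs]; first by rewrite !big_nil; exact: removable0.
by rewrite !big_cons; exact: (removableU M0 FMF (H i) IHs).
Qed.

(** A set meeting the boundary lies in a ball centred at a common point, which is far from [B]. The
    radius must exceed [d], possibly 0, to make the ball open and nonempty; the slack [e] pays for
    this. *)
Lemma removable_small_set (C : R) U (d e : R) :
  C = n%:R * MF * (4 / M) ^+ n ->
  0 <= d -> d <= rho / 4 -> 0 < e -> (forall x y, U x -> U y -> `|x - y| <= d) ->
  exists2 V, open V & U `&` bdry Omega `<=` V /\
    removable M Omega B F V (C * (d ^+ n.-1 + e)).
Proof.
move=> CE d0 drho e0 Ud.
have C0 : 0 <= C by rewrite CE !mulr_ge0 // exprn_ge0 // divr_ge0 // ltW.
have [[y [Uy by_]]|nU] := pselect (U `&` bdry Omega !=set0); last first.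
  exists set0; first exact: open0; split.
    by move=> x Ux; case: nU; exists x.
  apply: removable_sub (removable0 _ _ _ _) => //.
  by rewrite mulr_ge0 // addr_ge0 ?exprn_ge0 // ltW.
have [r [dr rrho re]] : exists r : R, [/\ d < r, r < rho / 2 & r ^+ n.-1 <= d ^+ n.-1 + e].
  have drho2 : d < rho / 2 by move: rho0 drho; lra.
  near d^'+ => r; exists r; split.
  - by near: r; exact: nbhs_right_gt.
  - by near: r; exact: nbhs_right_lt.
  - near: r; apply: (@cvgr_le _ _ _ _ _ (d ^+ n.-1)).
      apply: cvg_within_filter; exact: exprn_continuous.
    by rewrite ltrDl.
have r0 : 0 < r := le_lt_trans d0 dr.
exists (ball y r); first exact: ball_open.
split.
  by move=> x [Ux _]; rewrite -ball_normE /=; apply: le_lt_trans dr; exact: Ud.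
have := @removable_ball _ _ _ M0 Omega B F _ MF0 FMF y r r0.
move=> /(_ (fun x Bx => le_trans (_ : 2 * r <= rho) (Brho Bx by_))).
have r2 : 2 * r <= rho by lra.
move=> /(_ r2); apply: removable_sub => //.
have -> : n%:R * (MF / r) * (4 * r / M) ^+ n = C * r ^+ n.-1.
  have En (x : R) : x ^+ n = x * x ^+ n.-1 by rewrite -exprS prednK.
  rewrite CE (_ : 4 * r / M = 4 / M * r); last by ring.
  rewrite exprMn (En r); move: (r ^+ _) ((4 / M) ^+ _) => X Y.
  by field; rewrite gt_eqF.
by rewrite ler_wpM2l.
Unshelve. all: by end_near. Qed.

(** The boundary is compact and is covered by neighbourhoods of the singular sets and balls at
    regular points. The first have a total cost bounded in advance, eta / 2; the second share the
    other half once a finite subcover is known. *)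
Lemma removable_bdry (eta : R) : 0 < eta -> removable M Omega B F (bdry Omega) eta.
Proof.
move=> eta0; pose C := n%:R * MF * (4 / M) ^+ n.
have C0 : 0 <= C by rewrite !mulr_ge0 // exprn_ge0 // divr_ge0 // ltW.
pose e := eta / (4 * (C + 1)).
have e0 : 0 < e by rewrite divr_gt0 ?mulr_gt0 // ltr_wpDl.
have rho4 : 0 < rho / 4 by rewrite divr_gt0.
have [U [w [SU wsum w0 Uw]]] := hausdorff_null_cover Hnull rho4 e0.
have half0 k : 0 < e / 2 ^+ k.+1 by rewrite divr_gt0 ?exprn_gt0.
have /choice [V VP] : forall k, exists V, [/\ open V, U k `&` bdry Omega `<=` V &
    removable M Omega B F V (C * (w k + e / 2 ^+ k.+1))].
  move=> k; have [Uk|nUk] := pselect (U k !=set0).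
    have [d [d0 drho -> Ud]] := Uw _ Uk.
    by have [V Oop [UO remO]] := removable_small_set erefl d0 drho (half0 k) Ud; exists V.
  exists set0; split; first exact: open0.
    by move=> x [Ux _]; apply: nUk; exists x.
  apply: removable_sub (removable0 _ _ _ _) => //.
  by rewrite mulr_ge0 // addr_ge0 ?(ltW (half0 k)).
have /choice [E EP] : forall z, exists E, [/\ open E, regular_bdry Omega z -> E z &
    forall kappa : R, 0 < kappa -> removable M Omega B F E kappa].
  move=> z; have [rz|nrz] := pselect (regular_bdry Omega z); last first.
    exists set0; split=> // kappa k0.
    by apply: removable_sub (removable0 _ _ _ _) => //; exact: ltW.
  have [s s0 H] : exists2 s : R, 0 < s & forall kappa : R, 0 < kappa ->
      removable M Omega B F (ball z s) kappa.
    apply: (removable_regular M0 MF0 FMF Fc Fn rz); exists rho => // x Bx.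
    by apply: Brho => //; case: rz.
  exists (ball z s); split=> // [|_]; [exact: ball_open | exact: ballxx].
pose f (i : nat + 'rV[R]_n) := match i with inl k => V k | inr z => E z end.
have := compact_bdry; rewrite compact_cover => /(_ _ setT f) [].
- by case=> [k|z] _; [have [] := VP k | have [] := EP z].
- move=> x bx; have [rx|nrx] := pselect (regular_bdry Omega x).
    by exists (inr x) => //=; have [_ + _] := EP x; exact.
  have [k _ Ukx] := SU x (conj bx nrx).
  by exists (inl k) => //=; have [_ + _] := VP k; exact.
(* All [V k] with [k < K] are cut off, not only those selected, because the weights are bounded on
   initial segments. *)
move=> D' _ cover; pose D := finmap.enum_fset D'; pose K := (\max_(i <- D) (if i is inl k then k.+1 else 0))%N.
pose zs := pmap (fun i => if i is inr z then Some z else None) D.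
have remO : removable M Omega B F (\big[setU/set0]_(0 <= k < K) V k) (eta / 2).
  apply: (removable_sub (@subset_refl _ _) _
    (removable_bigU (c := fun k => C * (w k + e / 2 ^+ k.+1)) _ _)).
    rewrite /= -mulr_sumr big_split /= !big_mkord.
    have geo : \sum_(k < K) e / 2 ^+ k.+1 <= e.
      have -> : \sum_(k < K) e / 2 ^+ k.+1 = e * (1 - 2 ^- K).
        elim: (K) => [|k IH]; first by rewrite big_ord0 expr0 invr1 subrr mulr0.
        rewrite big_ord_recr /= IH exprS; field.
        by rewrite expf_eq0 pnatr_eq0 andbF.
      by rewrite -[leRHS]mulr1 ler_wpM2l ?(ltW e0) // gerBl invr_ge0 exprn_ge0.
    apply: le_trans (ler_wpM2l C0 (lerD (wsum K) geo)) _.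
    have -> : C * (e + e) = eta / 2 * (C / (C + 1)).
      by rewrite /e; field; rewrite gt_eqF // ltr_wpDl.
    rewrite -[leRHS]mulr1 ler_wpM2l ?divr_ge0 ?(ltW eta0) //.
    by rewrite ler_pdivrMr ?ltr_wpDl // mul1r lerDl.
  by move=> k; have [] := VP k.
have remE : removable M Omega B F (\big[setU/set0]_(z <- zs) E z) (eta / 2).
  (* The number of balls is now fixed; the successor covers the case of an empty list. *)
  pose k1 := eta / 2 / (size zs).+1%:R.
  have k10 : 0 < k1 by rewrite !divr_gt0.
  apply: (removable_sub (@subset_refl _ _) _ (removable_bigU (c := fun=> k1) _ _)).
    rewrite big_const_seq count_predT iter_addr_0 -[k1 *+ _]mulr_natr /k1 mulrAC ler_pdivrMr //.
    by rewrite ler_wpM2l ?ler_nat // divr_ge0 // ltW.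
  by move=> z; have [_ _] := EP z; exact.
rewrite [eta]splitr; apply: removable_sub (removableU M0 FMF remO remE) => // x /cover[i].
move=> Di fx; case: i fx Di => [k|z] /= fx Di; [left|right].
  rewrite -bigcup_seq; exists k => //=; rewrite mem_index_iota /=.
  by have := @leq_bigmax_seq _ D xpredT (fun i => if i is inl k then k.+1 else 0%N) (inl k); exact.
rewrite -bigcup_seq; exists z => //=; rewrite /zs mem_pmap; apply/mapP.
by exists (inr z).
Qed.

End boundary.

(** * The divergence argument *)

Lemma mean_sum (R : realType) (n : nat) (M : R) N (f : 'I_n -> 'rV[R]_n -> R) :
  mean M N (fun x => \sum_i f i x) = \sum_i mean M N (f i).
Proof. by rewrite /mean exchange_big /= mulr_suml. Qed.

Lemma near_shift (R : realType) (n : nat) (M : R) (x : 'rV[R]_n) (V : set 'rV[R]_n)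
    (i : 'I_n) : nbhs x V ->
  \forall y \near x & N \near \oo,
    [/\ V y, V (y + mesh M N *: e_ R i) & V (y - mesh M N *: e_ R i)].
Proof.
move=> /nbhs_ballP[r /= r0 xV].
have r20 : 0 < r / 2 by rewrite divr_gt0.
exists (ball x (r / 2), [set N | `|mesh M N| < r / 2]) => /=.
  split; first exact: nbhsx_ballx.
  by have /cvgr0_norm_lt/(_ _ r20) := @mesh_cvg0 R M.
move=> [y N] /= [xy hN]; split; apply: xV; move: xy; rewrite -!ball_normE /=.
- by move=> /lt_trans; apply; lra.
- rewrite opprD addrA => xy; apply: le_lt_trans (ler_normB _ _) _.
  by rewrite norm_scale_e; lra.
- rewrite opprB addrCA => xy; apply: le_lt_trans (ler_normD _ _) _.
  by rewrite norm_scale_e; lra.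
Qed.

Section divergence.
Variables (R : realType) (n : nat).
Hypothesis n_gt0 : (0 < n)%N.
Variable Omega : set 'rV[R]_n.
Hypothesis HOmega : piecewise_C1_domain Omega.
Variables (F : 'rV[R]_n -> 'rV[R]_n) (dF : 'I_n -> 'rV[R]_n -> R).
Hypothesis Fc : {within closure Omega, continuous F}.
Hypothesis FdF : forall x i, Omega x ->
  is_derive x (e_ R i) (fun y => F y 0 i) (dF i x).
Hypothesis dFc : forall x i, Omega x -> {for x, continuous (dF i)}.
Hypothesis Fn : forall x nu, bdry Omega x -> outward_unit_normal Omega x nu ->
  dot (F x) nu = 0.
Hypothesis dF_le0 : forall x, Omega x -> \sum_i dF i x <= 0.

(** The ball of twice the radius inside Omega keeps the smaller one at distance [r] from the
    boundary, as the cutoffs require. *)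
Lemma divergence_bump x0 : Omega x0 -> \sum_i dF i x0 < 0 ->
  exists r d : R, [/\ 0 < r, 0 < d, ball x0 (2 * r) `<=` Omega &
    forall x, ball x0 r x -> \sum_i dF i x <= - d].
Proof.
move=> Ox0 neg; have [Oo _ _ _ _] := HOmega.
have c : {for x0, continuous (fun x => \sum_i dF i x)}.
  apply: (@cvg_big _ _ _ _ _ _ _ (nbhs x0)) => [|i _]; last exact: dFc.
  exact: add_continuous.
pose d := - (\sum_i dF i x0) / 2.
have d0 : 0 < d by rewrite divr_gt0 // oppr_gt0.
have /nbhs_ballP[r /= r0 H] : \forall x \near x0, Omega x /\ \sum_i dF i x <= - d.
  near=> x; split; near: x; first exact: open_nbhs_nbhs.
  apply: (cvgr_le _ c); rewrite /d; lra.
exists (r / 2), d; split=> //; first exact: divr_gt0.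
- by move=> x; rewrite mulrC divfK // => /H[].
- move=> x xr; have [] // := H x; apply: le_ball xr; lra.
Unshelve. all: by end_near. Qed.

(* Testing the divergence against a cutoff [chi] of cost [eta] and summing by
   parts on the mesh leaves only [F . grad chi], whose mean is at most [eta]. *)
Lemma divergence_eq0 x0 : Omega x0 -> \sum_i dF i x0 = 0.
Proof.
move=> Ox0; apply/eqP; rewrite eq_le dF_le0 //= leNgt; apply/negP => neg.
have [r [d [r0 d0 rO rd]]] := divergence_bump Ox0 neg.
have [Oo _ _ Ob Hnull] := HOmega.
have [M [M0 OM xM]] : exists M : R, [/\ 0 < M, forall x, Omega x -> `|x| < M &
    `|x0| + r <= M].
  have : \forall A \near +oo, forall x, Omega x -> `|x| <= A by exact: Ob.
  move=> H; near (+oo : set_system R) => A; exists (A + 1); split.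
  - by apply: ltr_wpDl => //; near: A; exact: nbhs_pinfty_ge.
  - by move=> x Ox; rewrite ltr_pwDr //; move: x Ox; near: A.
  - by apply: ler_wpDr => //; near: A; exact: nbhs_pinfty_ge.
have clc := compact_closure M0 OM.
have [MF MF0 FMF] : exists2 MF : R, 0 <= MF & forall x i, Omega x -> `|F x 0 i| <= MF.
  have [A [_ HA]] := compact_bounded (continuous_compact Fc clc).
  exists (`|A| + 1); first by rewrite addr_ge0.
  move=> x i Ox; apply: le_trans (rV_coord_le _ _) _.
  apply: HA; first by rewrite (le_lt_trans (ler_norm A)) // ltrDl.
  by exists x => //; exact: subset_closure.
pose B := ball x0 r; have BO : B `<=` Omega.
  by move=> x xr; apply: rO; apply: le_ball xr; lra.
have Br x y : B x -> bdry Omega y -> r <= `|x - y|.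
  rewrite /B -ball_normE /= => xx0 [_ nOy]; rewrite leNgt; apply/negP => xy.
  apply: nOy; apply: rO; rewrite -ball_normE /= -[x0 - y](subrKA x).
  by apply: le_lt_trans (ler_normD _ _) _; lra.
pose c := (r / (4 * M)) ^+ n.
have c0 : 0 < c by rewrite exprn_gt0 // divr_gt0 // mulr_gt0.
(* The final comparison reads d * c <= 3 * e: two [e] from the cost of the cutoff and its slack, one
   from discretising the divergence. The value d * c / 4 contradicts it. *)
pose e := d * c / 4; have e0 : 0 < e by rewrite divr_gt0 // mulr_gt0.
have [chi [chi01 _ chiB chibd chicost]] :=
  removable_bdry n_gt0 M0 MF0 FMF Fc Fn Oo OM Hnull r0 Br e0.
(* Extension by 0 outside Omega gives the vanishing for |x| >= M that summation by parts
   requires. *)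
pose Fb i x := \1_Omega x * F x 0 i; pose chib x := \1_Omega x * chi x.
pose e' := e / n%:R.
have e'0 : 0 < e' by rewrite divr_gt0 // ltr0n.
have ind1 x : Omega x -> \1_Omega x = 1 :> R by move=> Ox; rewrite indicE mem_set.
(* Uniformity comes from compactness of the closure. Near an interior point this is
   differentiability of [F]; near a boundary point [chi] vanishes at the node and its neighbours,
   which hides the jump of [Fb] and any growth of the derivatives. *)
have H1 : \forall N \near \oo, forall x, closure Omega x -> forall i, Omega x ->
    chi x * `|Fb i (x + mesh M N *: e_ R i) - Fb i x - mesh M N * dF i x| <= e' * mesh M N
    /\ chib x - chib (x - mesh M N *: e_ R i) = chi x - chi (x - mesh M N *: e_ R i).
  suff H i : \forall N \near \oo, forall x, closure Omega x -> Omega x ->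
    chi x * `|Fb i (x + mesh M N *: e_ R i) - Fb i x - mesh M N * dF i x| <= e' * mesh M N
    /\ chib x - chib (x - mesh M N *: e_ R i) = chi x - chi (x - mesh M N *: e_ R i).
    near=> N.
    have HN : forall i x, closure Omega x -> Omega x ->
      chi x * `|Fb i (x + mesh M N *: e_ R i) - Fb i x - mesh M N * dF i x| <= e' * mesh M N
      /\ chib x - chib (x - mesh M N *: e_ R i) = chi x - chi (x - mesh M N *: e_ R i).
      by near: N; exact: filter_forall.
    by move=> x clx i; exact: HN.
  have /compact_near_coveringP := clc => /(_ _ \oo (fun N x => Omega x ->
    chi x * `|Fb i (x + mesh M N *: e_ R i) - Fb i x - mesh M N * dF i x| <= e' * mesh M N
    /\ chib x - chib (x - mesh M N *: e_ R i) = chi x - chi (x - mesh M N *: e_ R i))).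
  apply=> x clx; have [Ox|nOx] := pselect (Omega x).
    have bd : \forall y \near x, is_derive y (e_ R i) (fun y => F y 0 i) (dF i y).
      have : \forall y \near x, Omega y by exact: open_nbhs_nbhs.
      by apply: filterS => y /FdF; exact.
    have D := near_pair_comp (@mesh_cvg0 R M) (near_dir_diff e'0 bd (dFc Ox)).
    have S : nbhs x Omega by exact: open_nbhs_nbhs.
    apply: filterS2 (near_shift M i S) D => -[y N] /= [Oy Op Om] D Oy'.
    split; last by rewrite /chib !ind1 // !mul1r.
    rewrite /Fb !ind1 // !mul1r; have /andP[? ?] := chi01 y.
    rewrite -[leRHS]mul1r ler_pM //; apply: le_trans D _.
    by rewrite gtr0_norm // mesh_gt0.
  have bx : bdry Omega x by [].
  apply: filterS (near_shift M i (chibd _ bx bx)) => -[y N] /= [cy _ cm] Oy.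
  rewrite cy mul0r mulr_ge0 ?(ltW e'0) ?(ltW (mesh_gt0 M0 N)) //.
  by rewrite /chib cy cm !mulr0.
near (\oo : set_system nat) => N.
have HN : forall x, closure Omega x -> forall i, Omega x ->
    chi x * `|Fb i (x + mesh M N *: e_ R i) - Fb i x - mesh M N * dF i x| <= e' * mesh M N
    /\ chib x - chib (x - mesh M N *: e_ R i) = chi x - chi (x - mesh M N *: e_ R i).
  by near: N.
have costN : mean M N (fun x => \1_Omega x * `|dflux M F chi N x|) <= e + e.
  by near: N; exact: chicost.
have ballN : c <= mean M N \1_B by near: N; exact: mean_ball_ge.
set h := mesh M N in HN; have h0 : 0 < h := mesh_gt0 M0 N.
pose T := \sum_i mean M N (fun x => chib x * (Fb i (x + h *: e_ R i) - Fb i x)).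
have T1 : T <= h * (- d * mean M N \1_B + e).
  have -> : h * (- d * mean M N \1_B + e) =
      mean M N (fun x : 'rV[R]_n => h * (- d * \1_B x + e)).
    by rewrite meanZ meanD mean_cst // meanZ.
  rewrite /T -mean_sum.
  apply: le_mean => x; have [Ox|nOx] := pselect (Omega x); last first.
    rewrite big1 => [|i _]; last by rewrite /chib indicE memNset // !mul0r.
    rewrite [\1_B x]indicE memNset => [|/BO//].
    by rewrite mulr0 add0r mulr_ge0 // ltW.
  have /andP[chi0 chi1] := chi01 x.
  apply: (@le_trans _ _ (\sum_i (h * (chi x * dF i x) + e' * h))).
    apply: ler_sum => i _; rewrite /chib ind1 // mul1r.
    have [+ _] := HN x (subset_closure Ox) i Ox.
    rewrite -{1}(ger0_norm chi0) -normrM => /(le_trans (ler_norm _)); lra.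
  rewrite big_split /= sumr_const card_ord -[_ *+ n]mulr_natr -!mulr_sumr.
  have -> : e' * h * n%:R = h * e.
    by rewrite /e'; field; rewrite pnatr_eq0 -lt0n.
  rewrite -mulrDr ler_wpM2l ?(ltW h0) // lerD2r indicE.
  have [Bx|nBx] := pselect (B x).
    by rewrite chiB // mem_set // mul1r mulr1 rd.
  by rewrite memNset // mulr0 mulr_ge0_le0 // dF_le0.
have T2 : T = - mean M N (fun x => h * (\1_Omega x * dflux M F chi N x)).
  transitivity (- \sum_i mean M N (fun x => Fb i x * (chib x - chib (x - h *: e_ R i)))).
    rewrite -sumrN; apply: eq_bigr => i _; apply: mean_by_parts => // x xM'.
      by rewrite /chib indicE memNset ?mul0r // => /OM; rewrite ltNge xM'.
    by rewrite /Fb indicE memNset ?mul0r // => /OM; rewrite ltNge xM'.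
  rewrite -mean_sum; congr (- _); apply: eq_mean => x.
  have [Ox|nOx] := pselect (Omega x); last first.
    rewrite indicE memNset // mul0r mulr0 big1 // => i _.
    by rewrite /Fb indicE memNset // !mul0r.
  rewrite ind1 // mul1r /dflux mulr_sumr; apply: eq_bigr => i _.
  have [_ ->] := HN x (subset_closure Ox) i Ox.
  by rewrite /Fb ind1 // -/h; field; rewrite gt_eqF.
have T3 : - (h * (e + e)) <= T.
  rewrite T2 lerN2 meanZ ler_wpM2l ?(ltW h0) //; apply: le_trans costN.
  by apply: le_mean => x; rewrite ler_wpM2l ?ler_norm // indicE.
have := le_trans T3 T1; rewrite -mulrN ler_pM2l // => H.
have : d * c <= d * mean M N \1_B by rewrite ler_pM2l.
have : d * c = 4 * e by rewrite /e; field.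
by move: H; lra.
Unshelve. all: by end_near. Qed.

End divergence.

(** * Uniqueness *)

Section uniqueness_tools.
Variables (R : realType) (n : nat).
Implicit Types (Omega : set 'rV[R]_n) (u w z : 'rV[R]_n).

Lemma dotC u w : dot u w = dot w u.
Proof. by apply: eq_bigr => i _; rewrite mulrC. Qed.

Lemma dotBl u u' w : dot (u - u') w = dot u w - dot u' w.
Proof. by rewrite /dot -sumrB; apply: eq_bigr => i _; rewrite !mxE mulrBl. Qed.

Lemma dot0l w : dot 0 w = 0.
Proof. by rewrite /dot big1 // => i _; rewrite mxE mul0r. Qed.

Lemma mxapplyB (A : 'M[R]_n) u w : mxapply A (u - w) = mxapply A u - mxapply A w.
Proof. by rewrite /mxapply [(u - w)^T]raddfB mulmxBr raddfB. Qed.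

Lemma closure_cst (V : normedModType R) Omega (f : 'rV[R]_n -> V) (c : V) :
  {within closure Omega, continuous f} -> (forall x, Omega x -> f x = c) ->
  forall x, closure Omega x -> f x = c.
Proof.
move=> /subspace_continuousP fc Oc x clx; apply/eqP/negPn/negP => fxc.
have d0 : 0 < `|f x - c| by rewrite normr_gt0 subr_eq0.
have /cvgr_dist_lt/(_ _ d0) := fc x clx; rewrite near_withinE => H.
have [y [Oy /=]] := clx _ H.
by move=> /(_ (subset_closure Oy)) ; rewrite /from_subspace /= (Oc _ Oy) ltxx.
Qed.

(** Coercivity is assumed of K, not of its inverse: with w = K z the form w . K^-1 w becomes z . K
    z, positive unless z = 0. *)
Lemma permeability_inv Omega (K : 'rV[R]_n -> 'M[R]_n) (k1 k2 : R) x w :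
  permeability Omega K k1 k2 -> Omega x ->
  let z := mxapply (invmx (K x)) w in
  0 <= dot w z /\ (dot w z = 0 -> w = 0).
Proof.
move=> [k10 _ Ksym Kpos] Ox z.
have Kz u : u != 0 -> 0 < dot u (mxapply (K x) u).
  move=> u0; have /andP[+ _] := Kpos x u Ox u0; apply: lt_le_trans.
  by rewrite mulr_gt0 // dot_gt0.
(* [invmx] is the inverse only on [unitmx]. A row vector in the left kernel is, by symmetry, killed
   by K itself, against positivity. *)
have Ku : K x \in unitmx.
  rewrite -row_free_unit; apply: inj_row_free => v vK; apply/eqP/negPn/negP => v0.
  have := Kz v v0; rewrite /mxapply trmx_mul trmxK Ksym // vK dotC dot0l ltxx.
  by [].
have wE : w = mxapply (K x) z.
  by rewrite /z /mxapply trmxK mulKVmx // trmxK.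
have [z0|z0] := eqVneq z 0.
  rewrite wE z0 /mxapply linear0 mulmx0 linear0.
  by rewrite dot0l; split.
have := Kz z z0; rewrite -wE dotC => H; split; first exact: ltW.
by move=> H0; rewrite H0 ltxx in H.
Qed.

(** The mean value theorem on segments in a ball makes [q] locally constant, so {q = q x0} is open
    and closed relative to the connected set Omega. *)
Lemma grad0_cst Omega (q : 'rV[R]_n -> R) x0 : open Omega -> connected Omega ->
  Omega x0 -> (forall x, Omega x -> differentiable q x) ->
  (forall x, Omega x -> grad q x = 0) -> forall x, Omega x -> q x = q x0.
Proof.
move=> Oo Oc Ox0 qd q0.
have loc x : Omega x -> \forall y \near x, Omega y /\ q y = q x.
  move=> Ox; have /nbhs_ballP[r /= r0 xO] : nbhs x Omega by exact: open_nbhs_nbhs.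
  apply/nbhs_ballP; exists r => //= y xy; split; first exact: xO.
  have seg (s : R) : 0 <= s <= 1 -> Omega (x + (s * 1) *: (y - x)).
    move=> /andP[s0 s1]; apply: xO; move: xy; rewrite -!ball_normE /= mulr1.
    rewrite opprD addNKr normrN normrZ ger0_norm // distrC.
    by apply: le_lt_trans; rewrite ler_piMl.
  have [s s01] : exists2 s : R, 0 <= s <= 1 & q (x + 1 *: (y - x)) - q x =
      1 * 'D_(y - x) q (x + (s * 1) *: (y - x)).
    by apply: dir_MVT => s /seg/qd/diff_derivable.
  rewrite scale1r [x + (y - x)]addrC subrK mul1r => E; apply/eqP; rewrite -subr_eq0 E.
  set p := x + _; have Op : Omega p := seg _ s01.
  rewrite deriveE; last exact: qd.
  rewrite [y - x]row_sum_delta linear_sum big1 // => i _.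
  rewrite linearZ /= -deriveE; last exact: qd.
  have /rowP/(_ i) := q0 _ Op; rewrite !mxE => ->.
  by rewrite scaler0.
have : [set x | Omega x /\ q x = q x0] = Omega.
  apply: Oc.
  - by exists x0.
  - exists [set x | Omega x /\ q x = q x0].
      rewrite openE => x [Ox qx]; apply: filterS (loc x Ox) => y [Oy qy].
      by split=> //; rewrite qy.
    by apply/seteqP; split=> x //= [Ox []].
  exists (~` [set x | Omega x /\ q x != q x0]).
    apply: open_closedC; rewrite openE => x [Ox qx].
    by apply: filterS (loc x Ox) => y [Oy qy]; split=> //; rewrite qy.
  apply/seteqP; split=> x /= [Ox]; first by move=> qx; split=> // -[_]; rewrite qx eqxx.
  by move=> H; split=> //; apply/eqP/negPn/negP => qx; apply: H.
by move=> /seteqP[_ E] x /E[].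
Qed.

End uniqueness_tools.

(** An antiderivative of 1 / [barus]. At beta = 0 the viscosity factor is 1 and the exponential
    formula would divide by 0, so the identity takes its place. *)
Definition kirchhoff (R : realType) (beta p0 q : R) : R :=
  if beta == 0 then q else - (p0 / beta) * expR (- (beta * (q / p0 - 1))).

Section kirchhoff.
Variables (R : realType) (beta p0 : R).
Hypothesis p0_neq0 : p0 != 0.

Lemma kirchhoff_inj : injective (kirchhoff beta p0).
Proof.
move=> q q'; rewrite /kirchhoff; have [//|b0] := eqVneq beta 0.
move=> /mulfI H; have /H/expR_inj/oppr_inj/(mulfI b0)/addIr/divIf : - (p0 / beta) != 0.
  by rewrite oppr_eq0 mulf_neq0 // invr_eq0.
by apply.
Qed.

Lemma is_derive_kirchhoff (q : R) :
  is_derive q 1 (kirchhoff beta p0) (barus beta p0 q)^-1.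
Proof.
rewrite /barus -expRN /kirchhoff.
have [->|b0] := eqVneq beta 0.
  by rewrite mul0r oppr0 expR0; exact: is_derive_id.
pose lin t : R := - (beta * (t / p0 - 1)).
have linP : is_derive q 1 lin (- (beta / p0)).
  have H1 : is_derive q 1 (fun t : R => (- (beta / p0)) * t) (- (beta / p0)).
    have := is_deriveZ (- (beta / p0)) (is_derive_id q (1 : R)).
    by rewrite [_ *: 1]mulr1.
  have := is_deriveD H1 (is_derive_cst beta q (1 : R)); rewrite addr0.
  rewrite (_ : _ + _ = lin) //; apply/funext => t.
  by rewrite /lin !fctE /=; field.
have E := is_derive1_comp (is_derive_expR (lin q)) linP.
have := is_deriveZ (- (p0 / beta)) E.
rewrite (_ : _ *: _ = expR (lin q)) // -[_ *: _]/(_ * _).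
by field; rewrite b0 p0_neq0.
Qed.

Lemma continuous_kirchhoff : continuous (kirchhoff beta p0).
Proof.
move=> q; have [/derivable1_diffP/differentiable_continuous H _] :=
  is_derive_kirchhoff q.
exact: H.
Qed.

Lemma continuous_barus : continuous (barus beta p0).
Proof.
move=> q.
have H : {for q, continuous (fun t : R => beta * (t / p0 - 1))}.
  apply: continuousM; first exact: cvg_cst.
  apply: continuousB; last exact: cvg_cst.
  by apply: continuousM; [exact: cvg_id | exact: cvg_cst].
exact: (continuous_comp H (@continuous_expR R _)).
Qed.

End kirchhoff.

(** * Regularity and equations of a single transformed solution *)

Section difference.
Variables (R : realType) (n : nat) (Omega Gp Gv : set 'rV[R]_n).
Hypothesis Oo : open Omega.
Variables (K : 'rV[R]_n -> 'M[R]_n) (beta p0 : R) (m : 'rV[R]_n -> R).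
Hypothesis p0_neq0 : p0 != 0.
Variables (ppt vn p : 'rV[R]_n -> R) (v : 'rV[R]_n -> 'rV[R]_n).
Hypothesis Hsol : solution Omega Gp Gv m (barus beta p0) K ppt vn p v.

Let P x := kirchhoff beta p0 (p x).

Lemma kirchhoff_is_derive x i : Omega x ->
  is_derive x (e_ R i) P ((barus beta p0 (p x))^-1 * 'D_(e_ R i) p x).
Proof.
move=> Ox; have [[pd _] _] := solution_p_C1 Hsol.
apply: is_derive_chain; [exact: pd | | exact: is_derive_kirchhoff].
by apply: differentiable_is_derive; exact: pd.
Qed.

Lemma kirchhoff_differentiable x : Omega x -> differentiable P x.
Proof.
move=> Ox; have [[pd _] _] := solution_p_C1 Hsol.
apply: (@differentiable_comp _ _ _ _ p (kirchhoff beta p0)); first exact: pd.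
by apply/derivable1_diffP; have [] := is_derive_kirchhoff beta p0_neq0 (p x).
Qed.

Lemma kirchhoff_darcy x : Omega x ->
  grad P x = - (m x *: mxapply (invmx (K x)) (v x)).
Proof.
move=> Ox; have := solution_darcy Hsol Ox; move=> /eqP; rewrite addr_eq0 => /eqP D.
have g0 : barus beta p0 (p x) != 0 by rewrite gt_eqF // expR_gt0.
have -> : grad P x = (barus beta p0 (p x))^-1 *: grad p x.
  apply/rowP => i; rewrite !mxE.
  by have [_ ->] := kirchhoff_is_derive i Ox.
rewrite -[grad p x]opprK -D scalerN scalerA mulrCA mulVf ?mulr1 //.
Qed.

Lemma kirchhoff_continuous : {within closure Omega, continuous P}.
Proof.
have [_ pc] := solution_p_C1 Hsol.
by apply: within_continuous_comp pc => q _; exact: continuous_kirchhoff.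
Qed.

Lemma kirchhoff_grad_continuous x i : Omega x ->
  {for x, continuous (fun y => (barus beta p0 (p y))^-1 * 'D_(e_ R i) p y)}.
Proof.
move=> Ox; have [pC1 _] := solution_p_C1 Hsol; have [pd _] := pC1.
apply: (@continuousM _ _ (fun y => (barus beta p0 (p y))^-1) ('D_(e_ R i) p)); last first.
  exact: C1_on_continuous pC1 Ox.
apply: (@continuous_comp _ _ _ p (fun q => (barus beta p0 q)^-1)).
  exact: differentiable_continuous (pd _ Ox).
apply: continuousV; first by rewrite gt_eqF // expR_gt0.
exact: continuous_barus.
Qed.

(** [C1_on] speaks of derivatives of the vector field, [divergence] of derivatives of its
    coordinates; this identifies them. *)
Lemma velocity_is_derive x i j : Omega x ->
  is_derive x (e_ R j) (fun y => v y 0 i) ('D_(e_ R j) v x 0 i).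
Proof.
move=> Ox; have [[vd _] _] := solution_v_C1 Hsol.
have dv := @diff_derivable _ _ _ _ _ (e_ R j) (vd _ Ox).
rewrite (derive_mx dv) mxE; apply: derivableP.
by move/derivable_mxP : dv; exact.
Qed.

Lemma velocity_grad_continuous x i j : Omega x ->
  {for x, continuous (fun y => 'D_(e_ R j) v y 0 i)}.
Proof.
move=> Ox; have [vC1 _] := solution_v_C1 Hsol.
apply: (@continuous_comp _ _ _ ('D_(e_ R j) v) (fun u : 'rV[R]_n => u 0 i)).
  exact: C1_on_continuous vC1 Ox.
exact: coord_continuous.
Qed.

Lemma velocity_divergence x : Omega x -> \sum_i 'D_(e_ R i) v x 0 i = 0.
Proof.
move=> Ox; transitivity (divergence v x); last exact: (solution_div Hsol Ox).
apply: eq_bigr => i _.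
by have [_ ->] := velocity_is_derive i i Ox.
Qed.

End difference.

Theorem theorem8 (R : realType) (n : nat) (n_gt0 : (0 < n)%N)
  (Omega Gp Gv : set 'rV[R]_n)
  (HOmega : piecewise_C1_domain Omega)
  (HGU : Gp `|` Gv = bdry Omega) (HGI : Gp `&` Gv = set0)
  (K : 'rV[R]_n -> 'M[R]_n) (k1 k2 : R) (HK : permeability Omega K k1 k2)
  (mu0 beta p0 : R) (Hmu0 : 0 < mu0) (Hbeta : 0 <= beta) (Hp0 : p0 != 0)
  (rho : R) (b : 'rV[R]_n -> 'rV[R]_n) (xi : 'rV[R]_n -> R)
  (Hxi : forall x, Omega x ->
     differentiable xi x /\ rho *: b x = - grad xi x)
  (pp vn : 'rV[R]_n -> R)
  (Hvn : Gv = bdry Omega -> surface_integral (bdry Omega) vn = 0%E)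
  (p1 p2 : 'rV[R]_n -> R) (v1 v2 : 'rV[R]_n -> 'rV[R]_n)
  (Hsol1 : solution Omega Gp Gv (mut mu0 beta p0 xi) (barus beta p0) K
             (fun x => pp x + xi x) vn p1 v1)
  (Hsol2 : solution Omega Gp Gv (mut mu0 beta p0 xi) (barus beta p0) K
             (fun x => pp x + xi x) vn p2 v2) :
  (forall x, closure Omega x -> v1 x = v2 x) /\
  (Gp !=set0 -> forall x, closure Omega x -> p1 x = p2 x).

Proof.
have [Oo Oc [y0 Oy0] _ _] := HOmega.
set m := mut mu0 beta p0 xi in Hsol1 Hsol2.
have m0 x : 0 < m x by rewrite mulr_gt0 // expR_gt0.
pose q x := kirchhoff beta p0 (p1 x) - kirchhoff beta p0 (p2 x).
pose w x := v1 x - v2 x.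
pose dq i x := (barus beta p0 (p1 x))^-1 * 'D_(e_ R i) p1 x
  - (barus beta p0 (p2 x))^-1 * 'D_(e_ R i) p2 x.
pose dw i x := 'D_(e_ R i) v1 x 0 i - 'D_(e_ R i) v2 x 0 i.
have dqP x i : Omega x -> is_derive x (e_ R i) q (dq i x).
  by move=> Ox; apply: is_deriveB; [exact: (kirchhoff_is_derive Hp0 Hsol1) |
    exact: (kirchhoff_is_derive Hp0 Hsol2)].
have dwP x i : Omega x -> is_derive x (e_ R i) (fun y => w y 0 i) (dw i x).
  move=> Ox; rewrite (_ : (fun y => w y 0 i) = (fun y => v1 y 0 i) - (fun y => v2 y 0 i)).
    by apply: is_deriveB; [exact: (velocity_is_derive Hsol1) | exact: (velocity_is_derive Hsol2)].
  by apply/funext => y; rewrite !mxE.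
have gradq x : Omega x -> grad q x = - (m x *: mxapply (invmx (K x)) (w x)).
  move=> Ox; rewrite mxapplyB scalerBr opprB addrC -(kirchhoff_darcy Hp0 Hsol1 Ox).
  rewrite -[X in _ + X]opprK -(kirchhoff_darcy Hp0 Hsol2 Ox).
  apply/rowP => i; rewrite !mxE; have [_ ->] := dqP x i Ox.
  have [_ ->] := kirchhoff_is_derive Hp0 Hsol1 i Ox.
  by have [_ ->] := kirchhoff_is_derive Hp0 Hsol2 i Ox.
pose F x := q x *: w x.
pose dF i x := q x * dw i x + w x 0 i * dq i x.
have sumdF x : Omega x ->
    \sum_i dF i x = - (m x * dot (w x) (mxapply (invmx (K x)) (w x))).
  move=> Ox; rewrite big_split /= -mulr_sumr sumrB.
  rewrite (velocity_divergence Hsol1 Ox) (velocity_divergence Hsol2 Ox) subrr mulr0 add0r.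
  rewrite -mulNr -dotZr scaleNr -gradq //; apply: eq_bigr => i _.
  by rewrite [grad q x 0 i]mxE; have [_ ->] := dqP x i Ox.
have qc : {within closure Omega, continuous q}.
  by apply: within_continuousB; [exact: (kirchhoff_continuous Hp0 Hsol1) |
    exact: (kirchhoff_continuous Hp0 Hsol2)].
have wc : {within closure Omega, continuous w}.
  have [_ vc1] := solution_v_C1 Hsol1; have [_ vc2] := solution_v_C1 Hsol2.
  exact: within_continuousB.
have Fc : {within closure Omega, continuous F}.
  apply/subspace_continuousP => x clx.
  by apply: cvgZ; [have /subspace_continuousP := qc | have /subspace_continuousP := wc]; exact.
have FdF x i : Omega x -> is_derive x (e_ R i) (fun y => F y 0 i) (dF i x).
  move=> Ox; rewrite (_ : (fun y => F y 0 i) = q * (fun y => w y 0 i)).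
    exact: (is_deriveM (dqP x i Ox) (dwP x i Ox)).
  by apply/funext => y; rewrite [LHS]mxE.
have dFc x i : Omega x -> {for x, continuous (dF i)}.
  move=> Ox.
  have qcx : {for x, continuous q}.
    by apply: differentiable_continuous; apply: differentiableB;
      [exact: (kirchhoff_differentiable Hp0 Hsol1) | exact: (kirchhoff_differentiable Hp0 Hsol2)].
  have wcx : {for x, continuous (fun y => w y 0 i)}.
    apply: (@continuous_comp _ _ _ w (fun u : 'rV[R]_n => u 0 i)); last exact: coord_continuous.
    apply: continuousB; apply: differentiable_continuous.
      by have [[vd _] _] := solution_v_C1 Hsol1; exact: vd.
    by have [[vd _] _] := solution_v_C1 Hsol2; exact: vd.
  apply: (@continuousD _ _ _ (fun y => q y * dw i y) (fun y => w y 0 i * dq i y)).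
    apply: (@continuousM _ _ q (dw i)) => //; apply: continuousB.
      exact: (velocity_grad_continuous Oo Hsol1).
    exact: (velocity_grad_continuous Oo Hsol2).
  apply: (@continuousM _ _ (fun y => w y 0 i) (dq i)) => //; apply: continuousB.
    exact: (kirchhoff_grad_continuous Oo Hsol1).
  exact: (kirchhoff_grad_continuous Oo Hsol2).
have qGp x : Gp x -> q x = 0.
  by move=> Gx; rewrite /q (solution_Gp Hsol1 Gx) (solution_Gp Hsol2 Gx) subrr.
have Fn x nu : bdry Omega x -> outward_unit_normal Omega x nu -> dot (F x) nu = 0.
  rewrite -HGU => -[Gx|Gx] Hnu; first by rewrite /F qGp // scale0r dot0l.
  rewrite dotC dotZr dotC dotBl (solution_Gv Hsol1 Gx Hnu) (solution_Gv Hsol2 Gx Hnu).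
  by rewrite subrr mulr0.
have dF_le0 x : Omega x -> \sum_i dF i x <= 0.
  move=> Ox; rewrite sumdF // oppr_le0 mulr_ge0 ?(ltW (m0 x)) //.
  by have [] := permeability_inv (w x) HK Ox.
have w0 x : Omega x -> w x = 0.
  move=> Ox; have := divergence_eq0 n_gt0 HOmega Fc FdF dFc Fn dF_le0 Ox.
  rewrite sumdF // => /eqP; rewrite oppr_eq0 mulf_eq0 gt_eqF //= => /eqP.
  by have [_] := permeability_inv (w x) HK Ox; exact.
(* Vanishing of [w] gives only grad q = 0, so the pressures are compared through a point [z] of
   [Gp], where the constant value of [q] is 0. If [Gp] is empty and beta = 0, adding a constant to
   the pressure gives another solution. *)
split=> [x clx|[z Gz] x clx].
  by apply/eqP; rewrite -subr_eq0; apply/eqP; exact: (closure_cst wc w0 clx).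
have clz : closure Omega z.
  by have : bdry Omega z by [rewrite -HGU; left]; case.
have qcst y : Omega y -> q y = q y0.
  apply: grad0_cst => // u Ou.
    by apply: differentiableB; [exact: (kirchhoff_differentiable Hp0 Hsol1) |
      exact: (kirchhoff_differentiable Hp0 Hsol2)].
  by rewrite gradq // w0 // /mxapply linear0 mulmx0 linear0 scaler0 oppr0.
have q0 : q x = 0.
  by rewrite (closure_cst qc qcst clx) -(closure_cst qc qcst clz) qGp.
have inj : injective (kirchhoff beta p0) by exact: kirchhoff_inj.
by apply: inj; apply/eqP; rewrite -subr_eq0; apply/eqP.
Qed.
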